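(* The group $\mathrm{Gal}(\overline{\mathbb Q}/\mathbb Q)$ acts faithfully on the set of (isomorphism classes of) regular dessins.
   Context: Dessins. A dessin is an object of any of the following equivalent categories. (a) Compact oriented dessins without boundary: bipartite graphs on compact oriented surfaces whose complement is a disjoint union of open discs. (b) $\mathfrak{Sets}_{\sigma,\alpha,\phi}$: finite sets $D$ with permutations satisfying $\sigma\alpha\phi=1$ (acting on the right) and equivariant maps; $D$ is the set of darts (edges), $\sigma$ (resp. $\alpha$) takes a dart to the next one counterclockwise around its black (resp. white) vertex. (c) Compact Riemann surfaces $S$ with a meromorphic function $S\to\mathbb P^1$ unramified outside $\{0,1,\infty\}$, obtained by extending the covering of $\mathbb P^1(\mathbb C)\smallsetminus\{0,1,\infty\}$ with fibre $D$ over $\frac12$ and monodromy $\sigma,\alpha$ along the loops $t\mapsto\frac12e^{2i\pi t}$, $t\mapsto1-\frac12e^{2i\pi t}$. (d) (opposite category) $\mathfrak{Etale}(\overline{\mathbb Q}(x))$: finite-dimensional $\overline{\mathbb Q}(x)$-algebras $L$ which are direct sums of fields, unramified outside $\{0,1,\infty\}$, with $L\otimes_{\overline{\mathbb Q}(x)}\mathbb C(x)$ the algebra of meromorphic functions on $S$. Regularity. The degree of a dessin is its number of darts (the dimension of $L$ over $\overline{\mathbb Q}(x)$). A dessin is regular when it is connected and the order of its automorphism group equals its degree; equivalently, $L/\overline{\mathbb Q}(x)$ is a Galois field extension. Action. $\lambda\in\mathrm{Gal}(\overline{\mathbb Q}/\mathbb Q)$ is extended to $\overline{\mathbb Q}(x)$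 by fixing $x$, and acts on isomorphism classes of dessins by $L\mapsto{}^\lambda L=L\otimes_\lambda\overline{\mathbb Q}(x)$, an algebra over $\overline{\mathbb Q}(x)$ via $t\mapsto1\otimes t$; it preserves regular dessins. Faithful means that only the identity fixes every isomorphism class of regular dessins. *)

(* Defs.v *)
From HB Require Import structures.
From mathcomp Require Import all_boot all_order all_algebra all_field.

Set Implicit Arguments.
Unset Strict Implicit.
Unset Printing Implicit Defensive.

Import Order.TTheory GRing.Theory Num.Theory.
Local Open Scope ring_scope.
Local Open Scope quotient_scope.

(* Every ring endomorphism of algC fixes rat and is bijective (algC_autK,
   algC_invautK), so this is the whole group Gal(Qbar / Q). *)
Notation absGal := {rmorphism algC -> algC}.

Notation Qbarx := {fraction {poly algC}}.

Definition ratX : Qbarx := FracField.tofrac 'X.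
Definition ratC (c : algC) : Qbarx := FracField.tofrac c%:P.

(* The extension of lambda to Qbar(x) that fixes x; gal_ratE shows that the
   choice of numerator and denominator is irrelevant. *)
Definition gal_rat (lambda : absGal) (f : Qbarx) : Qbarx :=
  FracField.tofrac (map_poly lambda \n_(repr f))
    / FracField.tofrac (map_poly lambda \d_(repr f)).

Section GalRat.

Local Notation "p %:F" := (@FracField.tofrac {poly algC} p) (format "p %:F").
Implicit Types (lambda mu nu : absGal) (f g : Qbarx) (p q : {poly algC}).

Lemma fracE f : f = (\n_(repr f))%:F / (\d_(repr f))%:F.
Proof.
have d_neq0 : (\d_(repr f))%:F != 0 by rewrite tofrac_eq0 denom_ratioP.
apply: (mulIf d_neq0); rewrite mulfVK //.
rewrite -{1}[f]reprK; set r := repr f; unlock FracField.tofrac.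
rewrite -[LHS]FracField.pi_mul; apply/eqmodP => /=.
rewrite FracField.equivfE /FracField.mulf /=.
by rewrite !numden_Ratio ?mulr1 ?oner_neq0 ?denom_ratioP // mulrC.
Qed.

Lemma gal_ratE lambda p q : q != 0 ->
  gal_rat lambda (p%:F / q%:F) = (map_poly lambda p)%:F / (map_poly lambda q)%:F.
Proof.
move=> q_neq0; set f := p%:F / q%:F; rewrite /gal_rat.
have d_neq0 := denom_ratioP (repr f).
have /eqP := fracE f; rewrite {1}/f eqr_div ?tofrac_eq0 //.
rewrite -!rmorphM tofrac_eq => /eqP e.
apply/eqP; rewrite eqr_div ?tofrac_eq0 ?map_poly_eq0 //.
by rewrite -!rmorphM e.
Qed.

Lemma gal_rat_tofrac lambda p : gal_rat lambda p%:F = (map_poly lambda p)%:F.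
Proof.
by have := gal_ratE lambda p (oner_neq0 _); rewrite !rmorph1 invr1 !mulr1.
Qed.

Fact gal_rat_is_zmod_morphism lambda : zmod_morphism (gal_rat lambda).
Proof.
move=> f g; rewrite [f]fracE [g]fracE.
have := denom_ratioP (repr f); have := denom_ratioP (repr g).
move: \n_(repr f) \d_(repr f) \n_(repr g) \d_(repr g) => a b c d d0 b0.
have nz p : p != 0 -> p%:F != 0 by rewrite tofrac_eq0.
rewrite -mulNr addf_div ?nz // -rmorphN -!rmorphM -rmorphD.
rewrite !gal_ratE ?mulf_neq0 // -mulNr addf_div ?nz ?map_poly_eq0 //.
by rewrite -rmorphN -!rmorphM -rmorphD /= !rmorphM !rmorphD !rmorphM !rmorphN.
Qed.

Fact gal_rat_is_monoid_morphism lambda : monoid_morphism (gal_rat lambda).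
Proof.
split=> [|f g]; first by rewrite -(rmorph1 (@FracField.tofrac _)) gal_rat_tofrac
  !rmorph1.
rewrite [f]fracE [g]fracE.
have := denom_ratioP (repr f); have := denom_ratioP (repr g).
move: \n_(repr f) \d_(repr f) \n_(repr g) \d_(repr g) => a b c d d0 b0.
by rewrite mulf_div -!rmorphM !gal_ratE ?mulf_neq0 // mulf_div -!rmorphM.
Qed.

HB.instance Definition _ lambda := GRing.isZmodMorphism.Build Qbarx Qbarx
  (gal_rat lambda) (gal_rat_is_zmod_morphism lambda).
HB.instance Definition _ lambda := GRing.isMonoidMorphism.Build Qbarx Qbarx
  (gal_rat lambda) (gal_rat_is_monoid_morphism lambda).

Lemma gal_rat_comp lambda mu nu : lambda =1 mu \o nu ->
  gal_rat lambda =1 gal_rat mu \o gal_rat nu.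
Proof.
move=> e f /=; rewrite [f]fracE; have d0 := denom_ratioP (repr f).
rewrite !gal_ratE ?map_poly_eq0 // -!map_poly_comp.
by congr (_%:F / _%:F); apply: eq_map_poly.
Qed.

Lemma gal_rat_id lambda : lambda =1 id -> gal_rat lambda =1 id.
Proof.
move=> e f /=; rewrite [f]fracE; have d0 := denom_ratioP (repr f).
rewrite gal_ratE //.
by congr (_%:F / _%:F); apply: map_poly_id => ? _; apply: e.
Qed.

Lemma gal_ratK lambda : cancel (gal_rat lambda) (gal_rat (algC_invaut lambda)).
Proof.
move=> f; rewrite -[LHS](@gal_rat_comp idfun (algC_invaut lambda) lambda).
  exact: gal_rat_id.
by move=> z; rewrite /= algC_autK.
Qed.

Lemma gal_ratVK lambda : cancel (gal_rat (algC_invaut lambda)) (gal_rat lambda).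
Proof.
move=> f; rewrite -[LHS](@gal_rat_comp idfun lambda (algC_invaut lambda)).
  exact: gal_rat_id.
by move=> z; rewrite /= algC_invautK.
Qed.

Lemma gal_ratX lambda : gal_rat lambda ratX = ratX.
Proof. by rewrite gal_rat_tofrac map_polyX. Qed.

Lemma gal_ratC lambda c : gal_rat lambda (ratC c) = ratC (lambda c).
Proof. by rewrite gal_rat_tofrac map_polyC. Qed.

End GalRat.

(* The tensor product of L with Qbar(x) along lambda.  As lambda is bijective,
   l |-> l (x) 1 identifies it with the ring L, and
   t . (l (x) 1) = l (x) t = (lambda^-1(t) l) (x) 1.
   Its universal property is gal_conjP below. *)
Definition gal_conj (lambda : absGal) (L : falgType Qbarx) : Type := L.

Section GalConj.

Variables (lambda : absGal) (L : falgType Qbarx).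
Local Notation cL := (gal_conj lambda L).
Local Notation inv := (gal_rat (algC_invaut lambda)).

HB.instance Definition _ := GRing.UnitRing.on cL.

Definition gal_conj_scale (t : Qbarx) (l : cL) : cL := inv t *: (l : L).

Fact gal_conj_scaleA a b (l : cL) :
  gal_conj_scale a (gal_conj_scale b l) = gal_conj_scale (a * b) l.
Proof. by rewrite /gal_conj_scale rmorphM scalerA. Qed.

Fact gal_conj_scale1 : left_id 1 gal_conj_scale.
Proof. by move=> l; rewrite /gal_conj_scale rmorph1 scale1r. Qed.

Fact gal_conj_scaleDr : right_distributive gal_conj_scale +%R.
Proof. by move=> a l m; rewrite /gal_conj_scale scalerDr. Qed.

Fact gal_conj_scaleDl (l : cL) : {morph gal_conj_scale^~ l : a b / a + b}.
Proof. by move=> a b; rewrite /gal_conj_scale rmorphD scalerDl. Qed.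

HB.instance Definition _ := GRing.Zmodule_isLmodule.Build Qbarx cL
  gal_conj_scaleA gal_conj_scale1 gal_conj_scaleDr gal_conj_scaleDl.

Lemma gal_conj_scaleE (t : Qbarx) (l : cL) : t *: l = (inv t *: (l : L) : L).
Proof. by []. Qed.

Fact gal_conj_scaleAl a (l m : cL) : a *: (l * m) = (a *: l) * m.
Proof. exact: (@scalerAl _ L). Qed.

HB.instance Definition _ := GRing.Lmodule_isLalgebra.Build Qbarx cL
  gal_conj_scaleAl.

Fact gal_conj_scaleAr a (l m : cL) : a *: (l * m) = l * (a *: m).
Proof. exact: (@scalerAr _ L). Qed.

HB.instance Definition _ := GRing.Lalgebra_isAlgebra.Build Qbarx cL
  gal_conj_scaleAr.

Fact gal_conj_vect_axiom : Vector.axiom (\dim {:L}) cL.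
Proof.
pose b := vbasis {:L}.
have bL : basis_of {:L} b := vbasisP _.
pose to (l : cL) : 'rV[Qbarx]_(\dim {:L}) :=
  \row_i gal_rat lambda (coord b i (l : L)).
pose from (v : 'rV[Qbarx]_(\dim {:L})) : cL := \sum_i inv (v 0 i) *: b`_i.
exists to.
  by move=> a l m; apply/rowP => i; rewrite !mxE gal_conj_scaleE linearD linearZ
    rmorphD rmorphM /= gal_ratVK.
exists from => [l | v].
  rewrite /from [RHS](coord_basis bL (memvf (l : L))).
  by apply: eq_bigr => i _; rewrite mxE gal_ratK.
apply/rowP => i; rewrite mxE /from coord_sum_free ?gal_ratVK //.
exact: basis_free bL.
Qed.

HB.instance Definition _ := Lmodule_hasFinDim.Build Qbarx cL gal_conj_vect_axiom.

End GalConj.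

HB.instance Definition _ (lambda : absGal) (E : fieldExtType Qbarx) :=
  GRing.Field.on (gal_conj lambda E).

Lemma gal_conjP (lambda : absGal) (L : falgType Qbarx) :
  (forall a (l : L), (a *: l : L) = gal_rat lambda a *: (l : gal_conj lambda L))
  /\ (forall (M : algType Qbarx) (g : {rmorphism L -> M}),
        (forall a l, g (a *: l) = gal_rat lambda a *: g l) ->
      exists2 h : {lrmorphism gal_conj lambda L -> M},
        (forall l : L, h l = g l)
        & forall h' : {lrmorphism gal_conj lambda L -> M},
            (forall l : L, h' l = g l) -> h' =1 h).
Proof.
split=> [a l | M g gZ]; first by rewrite gal_conj_scaleE gal_ratK.
pose h : gal_conj lambda L -> M := g.
have hZ : scalable h by move=> a l; rewrite gal_conj_scaleE /h gZ gal_ratVK.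
pose hZ' := GRing.isScalable.Build _ _ _ _ h hZ.
pose h0 : {rmorphism gal_conj lambda L -> M} := g.
pose hL : {lrmorphism gal_conj lambda L -> M} :=
  HB.pack h (GRing.RMorphism.class h0) hZ'.
by exists hL => // h' e l; rewrite e.
Qed.

Lemma gal_conj_inA (lambda : absGal) (L : falgType Qbarx) (t : Qbarx) :
  (t%:A : gal_conj lambda L) = (gal_rat (algC_invaut lambda) t)%:A :> L.
Proof. by []. Qed.

Section GalConjMap.

Variables (lambda : absGal) (L M : falgType Qbarx) (f : {lrmorphism L -> M}).

Definition gal_conj_map : gal_conj lambda L -> gal_conj lambda M := f.

HB.instance Definition _ := GRing.RMorphism.copy gal_conj_map f.

Fact gal_conj_map_is_scalable : scalable gal_conj_map.
Proof. by move=> a l; rewrite !gal_conj_scaleE /gal_conj_map linearZ. Qed.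

HB.instance Definition _ := GRing.isScalable.Build Qbarx
  (gal_conj lambda L) (gal_conj lambda M) *:%R gal_conj_map
  gal_conj_map_is_scalable.

End GalConjMap.

Arguments gal_conj_map lambda {L M} f.

(* Normalized discrete valuations of E that are trivial on Qbar.  The value at
   0 should be +oo; here it is an arbitrary integer, which no axiom uses. *)
Record discrete_valuation (E : fieldExtType Qbarx) (w : E -> int) : Prop :=
  DiscreteValuation {
    valuationM : forall f g, f != 0 -> g != 0 -> w (f * g) = w f + w g;
    valuationD : forall f g, f != 0 -> g != 0 -> f + g != 0 ->
      Num.min (w f) (w g) <= w (f + g);
    valuation_const : forall c, c != 0 -> w (ratC c)%:A = 0;
    valuation_onto : exists2 f, f != 0 & w f = 1
  }.

(* x - a is a uniformizer of the place a of Qbar(x): w lies above that place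
   when w (x - a) > 0, and w (x - a) is then its ramification index.  Residue
   fields are all equal to Qbar, so separability is automatic. *)
Definition unramified_at (E : fieldExtType Qbarx) (a : algC) : Prop :=
  forall w : E -> int, discrete_valuation w ->
    0 < w (ratX - ratC a)%:A -> w (ratX - ratC a)%:A = 1.

(* L is isomorphic to the product of the fields E i.  Commutativity of L
   follows; the zero algebra (the empty dessin) is not a falgType. *)
Definition is_dessin (L : falgType Qbarx) : Prop :=
  exists (n : nat) (E : 'I_n -> fieldExtType Qbarx)
         (p : forall i, {lrmorphism L -> E i}),
    (forall e : forall i, E i, exists! l : L, forall i, p i l = e i)
    /\ (forall i a, a != 0 -> a != 1 -> unramified_at (E i) a).

Record dessin := Dessin {
  dessin_alg :> falgType Qbarx;
  dessinP : is_dessin dessin_alg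
}.

Definition dessin_iso (D D' : dessin) : Prop :=
  exists f : {lrmorphism D -> D'}, bijective f.

(* A direct sum of fields is connected when it has exactly one summand. *)
Definition connected (D : dessin) : Prop := GRing.field_axiom D.

Definition degree (D : dessin) : nat := \dim {:D}.

Definition aut_order (D : dessin) (m : nat) : Prop :=
  exists s : seq 'AEnd(D),
    [/\ uniq s, forall f : 'AEnd(D), f \in s <-> bijective f & size s = m].

Definition regular (D : dessin) : Prop :=
  connected D /\ aut_order D (degree D).

Lemma gal_conj_unramified (lambda : absGal) (E : fieldExtType Qbarx) :
  (forall a, a != 0 -> a != 1 -> unramified_at E a) ->
  forall a, a != 0 -> a != 1 -> unramified_at (gal_conj lambda E) a.
Proof.
move=> unrE a a_neq0 a_neq1 w [wM wD wC wS].
have -> : ((ratX - ratC a)%:A : gal_conj lambda E) =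
    ((ratX - ratC (algC_invaut lambda a))%:A : E).
  by rewrite gal_conj_inA rmorphB /= gal_ratX gal_ratC.
apply: (unrE (algC_invaut lambda a)); rewrite ?fmorph_eq0 ?fmorph_eq1 //.
split=> // c c_neq0.
have -> : ((ratC c)%:A : E) = ((ratC (lambda c))%:A : gal_conj lambda E).
  by rewrite gal_conj_inA gal_ratC /= algC_autK.
by apply: wC; rewrite fmorph_eq0.
Qed.

Fact gal_conj_is_dessin (lambda : absGal) (D : dessin) :
  is_dessin (gal_conj lambda D).
Proof.
have [n [E [p [pP unrE]]]] := dessinP D.
exists n, (fun i => gal_conj lambda (E i)), (fun i => gal_conj_map lambda (p i)).
by split=> [|i]; [apply: pP | apply: gal_conj_unramified (unrE i)].
Qed.

Definition gal_dessin (lambda : absGal) (D : dessin) : dessin :=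
  Dessin (gal_conj_is_dessin lambda D).

(* Main.v *)
(* For lambda fixing every class we show lambda a = a.  Suppose b = lambda a
   differs from a.  A variant of Belyi's theorem gives B = P/Q in Q(s),
   unramified outside {0, 1, oo}, with B(a) = 0 (after replacing a by a Moebius
   image with rational coefficients) and a SIMPLE pole at s = oo.  Let E be the
   Galois closure of Qbar(s)/Qbar(x), x = B(s), with s_1, ..., s_d the conjugates
   of s, let p be a prime > d^d, and let L be obtained from E by adjoining the
   p-th roots of all s_i - a.  L is the function field of a regular dessin; if it
   is isomorphic to its conjugate then some s_1 - b is a p-th power in L, so by
   Kummer theory s_1 - b = z^p prod_i (s_i - a)^(c_i) in E.  Since B is unramified
   at oo, among the s_i - a only s_j - a has a pole or a zero above s_j = oo:
   taking orders at s_j = oo of norms from E to Qbar(s_j), whose degree is prime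
   to p, gives c_1 = 1 and c_j = 0 (j > 1) modulo p.  Then the norm of
   (s_1 - b) / (s_1 - a) to Qbar(s_1) is a p-th power, although its order at
   s_1 = a is minus this degree. *)

From HB Require Import structures.
Require Import Defs.
From mathcomp Require Import all_boot all_order all_algebra all_field.
From mathcomp Require Import ring lra zify.
From Stdlib Require Import Classical ClassicalEpsilon.

Set Implicit Arguments.
Unset Strict Implicit.
Unset Printing Implicit Defensive.

Import Order.TTheory GRing.Theory Num.Theory.
Local Open Scope ring_scope.

(** The extension E alone cannot detect lambda: B has rational coefficients, so E is isomorphic to
    all its conjugates. The p-th roots of the s_i - a mark the point a, and the ramification which
    they add lies above x = 0 and x = oo, where it is allowed. A polynomial Belyi function b would
    not do for B: it is totally ramified at s = oo, all s_i - a would have the same order at each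
    place above oo, and only the sum of the c_i could be read off. Hence b is composed with a
    rational function h having a simple pole at an integer k + 2, and a rational point c with b(c) =
    k + 2 is moved to oo. Such a c exists because b is arranged to be nonnegative on the rationals,
    with b(0) = 1; and c is not critical, since the critical values of b are 0 and 1. No place of E
    is ever constructed. Orders are multiplicities of roots in Qbar(s_j), and elements of E are
    brought there by norms. Unramifiedness, a statement about all discrete valuations, is obtained
    by approximating the generators of L by polynomials in x. *)

Local Notation pC := (map_poly (ratr : rat -> algC)).

(** * Splitting fields *)

Lemma irreducible_factor (F : fieldType) (p : {poly F}) :
  (1 < size p)%N -> exists2 r : {poly F}, r %| p & irreducible_poly r.
Proof.
have [n] := ubnP (size p); elim: n p => // n IHn p lt_p_n p_gt1.
have [irr_p | red_p] := classic (irreducible_poly p); first by exists p.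
have [q [q_neq1 q_dv_p qNp]] :
    exists q : {poly F}, [/\ size q != 1, q %| p & ~~ (q %= p)].
  apply: NNPP => noq; apply: red_p; split=> // q q_neq1 q_dv_p.
  by apply/negPn/negP => qNp; apply: noq; exists q.
have p_neq0 : p != 0 by rewrite -size_poly_gt0 ltnW.
have lt_q_p : (size q < size p)%N.
  by rewrite ltn_neqAle dvdp_leq // andbT dvdp_size_eqp.
have q_gt1 : (1 < size q)%N.
  by rewrite ltn_neqAle eq_sym q_neq1 size_poly_gt0 (dvdpN0 q_dv_p).
have [r r_dv_q irr_r] := IHn q (leq_trans lt_q_p lt_p_n) q_gt1.
by exists r => //; apply: dvdp_trans r_dv_q q_dv_p.
Qed.

Section SplittingField.

Let map_poly_extField (F : fieldType) (L : fieldExtType F) :=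
  map_poly (in_alg L) : {poly F} -> {poly L}.

Local Notation "p ^%:A" := (map_poly_extField _ p)
  (at level 2, format "p ^%:A") : ring_scope.

Let splits (L : fieldType) (q : {poly L}) :=
  exists zs, q %= \prod_(z <- zs) ('X - z%:P).

(** The base field varies in the induction: one root is adjoined to F, the cofactor is split over
    the resulting field K, and [baseFieldType] turns the extension of K into one of F. *)
Lemma splitting_extension (F : fieldType) (p : {poly F}) :
  p != 0 -> exists L : fieldExtType F, splits (p^%:A : {poly L}).
Proof.
have [n] := ubnP (size p); elim: n F p => // n IHn F p lt_p_n nz_p.
have [Cp | C'p] := leqP (size p) 1.
  exists F^o, [::].
  by rewrite big_nil -size_poly_eq1 size_map_poly eqn_leq Cp size_poly_gt0.
have [r r_dv_p irr_r] := irreducible_factor C'p.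
have [K _ [x rx0 defK]] := irredp_FAdjoin irr_r.
have /factor_theorem[q Dp] : root p^%:A x.
  by rewrite -(divpK r_dv_p) [_^%:A]rmorphM rootM rx0 orbT.
have Dszp : size p = size (q * ('X - x%:P)) by rewrite -Dp size_map_poly.
have nz_q : q != 0.
  by move: nz_p; rewrite -size_poly_eq0 Dszp size_poly_eq0 mulf_eq0 => /norP[].
have [|L [zs Dq]] := IHn K q _ nz_q.
  by rewrite Dszp size_mul ?polyXsubC_eq0 ?size_XsubC ?addn2 in lt_p_n.
suffices: splits ((p^%:A : {poly K})^%:A : {poly L}).
  rewrite /map_poly_extField -map_poly_comp.
  rewrite -(eq_map_poly (fun a : F => baseField_scaleE a (1 : L))).
  by exists (baseFieldType L).
exists (x%:A :: zs); rewrite big_cons; set rhs := _ * _.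
by rewrite Dp mulrC [_^%:A]rmorphM /= /map_poly_extField map_polyXsubC eqp_mull.
Qed.

Lemma splitting_field_exists (F : fieldType) (p : {poly F}) : p != 0 ->
  exists L : splittingFieldType F,
    splittingFieldFor 1 (map_poly (in_alg L) p) {:L}.
Proof.
move=> /splitting_extension[L [ys Dp]].
have mapXsubC (f : {rmorphism _ -> _}) x:
    map_poly f ('X - x%:P) = 'X - (f x)%:P.
  by rewrite rmorphB /= map_polyX map_polyC.
suffices [M splitMp] : exists M : fieldExtType F,
    splittingFieldFor 1 (map_poly (in_alg M) p) {:M}.
  have ax : SplittingField.axiom M.
    exists (map_poly (in_alg M) p) => //.
    by apply/polyOverP=> i; rewrite coef_map /= rpredZ ?rpred1.
  pose S := FieldExt_isSplittingField.Build F M ax.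
  pose MS : splittingFieldType F := HB.pack (FieldExt.sort M) S.
  by exists MS.
(* L may be larger than the field generated by the roots, so it is cut down to that subfield. *)
pose Lp := subvs_of <<1 & ys>>; pose toL := linfun (vsval : Lp -> L).
have [zs Dys]: {zs | map toL zs = ys}.
  exists (map (vsproj _) ys); rewrite -map_comp map_id_in // => y ys_y.
  by rewrite /= lfunE /= vsprojK ?seqv_sub_adjoin.
exists Lp, zs.
  set lhs := (lhs in lhs %= _); set rhs := (rhs in _ %= rhs).
  suffices: map_poly toL lhs %= map_poly toL rhs by rewrite eqp_map.
  rewrite -Dys big_map in Dp; apply: etrans Dp; apply: congr2.
    by rewrite -map_poly_comp; apply/eq_map_poly=> x; apply: rmorph_alg.
  by rewrite rmorph_prod; apply/eq_bigr=> z _; apply: mapXsubC.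
set Lzs := LHS; pose Lys := (toL @: Lzs)%VS; apply/vspaceP=> u.
have: val u \in Lys by rewrite /Lys aimg_adjoin_seq aimg1 Dys (valP u).
by case/memv_imgP=> v Lzs_v; rewrite memvf lfunE => /val_inj->.
Qed.

End SplittingField.

(** * The Galois action on regular dessins *)

Lemma gal_dessin_iso (lambda : absGal) (D D' : dessin) :
  dessin_iso D D' -> dessin_iso (gal_dessin lambda D) (gal_dessin lambda D').
Proof. by case=> f bij_f; exists (gal_conj_map lambda f). Qed.

Lemma algC_invaut_comp (lambda mu : absGal) :
  algC_invaut (lambda \o mu) =1 algC_invaut mu \o algC_invaut lambda.
Proof.
move=> c; rewrite -[c in LHS](algC_invautK lambda).
by rewrite -[X in lambda X](algC_invautK mu) [LHS](algC_autK (lambda \o mu)).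
Qed.

Lemma gal_dessin_idfun (D : dessin) : dessin_iso (gal_dessin idfun D) D.
Proof.
pose f : gal_conj idfun D -> D := idfun.
have fZ : scalable f.
  move=> a l; rewrite gal_conj_scaleE /f /=; congr (_ *: _).
  by apply: gal_rat_id => c; rewrite -[LHS]/(idfun _) (algC_invautK idfun).
pose fZ' := GRing.isScalable.Build _ _ _ _ f fZ.
pose f0 : {rmorphism gal_conj idfun D -> D} := idfun.
pose fL : {lrmorphism gal_conj idfun D -> D} :=
  HB.pack f (GRing.RMorphism.class f0) fZ'.
by exists fL; exists id.
Qed.

Lemma gal_dessin_comp (lambda mu : absGal) (D : dessin) :
  dessin_iso (gal_dessin (lambda \o mu) D)
             (gal_dessin lambda (gal_dessin mu D)).
Proof.
pose f : gal_conj (lambda \o mu) D -> gal_conj lambda (gal_dessin mu D)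
  := idfun.
have fZ : scalable f.
  move=> a l; rewrite gal_conj_scaleE.
  by rewrite (gal_rat_comp (@algC_invaut_comp lambda mu)).
pose fZ' := GRing.isScalable.Build _ _ _ _ f fZ.
pose f0 : {rmorphism gal_conj (lambda \o mu) D
                      -> gal_conj lambda (gal_dessin mu D)} := idfun.
pose fL : {lrmorphism _ -> _} := HB.pack f (GRing.RMorphism.class f0) fZ'.
by exists fL; exists id.
Qed.

Section GalConjAut.

Variables (lambda : absGal) (L : falgType Qbarx).

Definition gal_conj_aut (f : 'AEnd(L)) : 'AEnd(gal_conj lambda L) :=
  linfun_ahom (gal_conj_map lambda f
    : {lrmorphism gal_conj lambda L -> gal_conj lambda L}).

Lemma gal_conj_autE f (l : L) : gal_conj_aut f l = f l.
Proof. by rewrite lfunE. Qed.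

Lemma gal_conj_aut_inj : injective gal_conj_aut.
Proof.
move=> f g eq_fg; apply/val_inj/lfunP => l.
by rewrite -gal_conj_autE eq_fg gal_conj_autE.
Qed.

Lemma gal_conj_aut_surj g : exists f, gal_conj_aut f = g.
Proof.
pose f : L -> L := g.
have fZ : scalable f.
  move=> a l; have e := (gal_conjP lambda L).1 a.
  have gZ b (m : gal_conj lambda L) : g (b *: m) = b *: g m by rewrite linearZ.
  exact: etrans (congr1 g (e l)) (etrans (gZ _ _) (esym (e (g l)))).
pose fZ' := GRing.isScalable.Build _ _ _ _ f fZ.
pose f0 : {rmorphism L -> L} :=
  (g : {rmorphism gal_conj lambda L -> gal_conj lambda L}).
pose fL : {lrmorphism L -> L} := HB.pack f (GRing.RMorphism.class f0) fZ'.
exists (linfun_ahom fL); apply/val_inj/lfunP => l.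
by rewrite gal_conj_autE lfunE.
Qed.

End GalConjAut.

Lemma gal_dessin_regular (lambda : absGal) (D : dessin) :
  regular D -> regular (gal_dessin lambda D).
Proof.
case=> conD [s [uniq_s s_bij size_s]]; split; first exact: conD.
exists (map (@gal_conj_aut lambda D) s); split.
- by rewrite map_inj_uniq //; apply: gal_conj_aut_inj.
- move=> g; have [f <-] := gal_conj_aut_surj g.
  rewrite mem_map ?s_bij; last exact: gal_conj_aut_inj.
  have e := gal_conj_autE lambda f.
  split=> [[h fK hK] | [h fK hK]]; exists h => l.
  - exact: etrans (congr1 h (e l)) (fK l).
  - exact: etrans (e (h l)) (hK l).
  - exact: etrans (congr1 h (esym (e l))) (fK l).
  exact: etrans (esym (e (h l))) (hK l).
by rewrite size_map size_s /degree [RHS]dimvf.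
Qed.

(** [gal_of {:L}] identifies automorphisms that agree on [{:L}], which is all of L; representatives
    of its elements therefore exhaust ['AEnd(L)]. *)
Lemma galois_aut_order (F : fieldType) (L : splittingFieldType F) :
  galois 1 {:L} -> exists s : seq 'AEnd(L),
    [/\ uniq s, forall f : 'AEnd(L), f \in s <-> bijective f
      & size s = \dim {:L}].
Proof.
move=> galL.
exists [seq gal_repr x | x <- enum [set: gal_of {:L}]]; split.
- by rewrite map_inj_uniq ?enum_uniq //; apply: gal_repr_inj.
- move=> f; split=> [_ | _].
    exists (f^-1)%VF => l; [apply: lker0_lfunK | apply: lker0_lfunVK];
      exact: AEnd_lker0.
  apply/mapP; exists (gal {:L} f); first by rewrite mem_enum inE.
  apply/val_inj/lfunP => l /=; rewrite galK ?memvf ?subvf //.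
have := galois_dim galL; rewrite dimv1 divn1 => ->.
rewrite size_map -cardE; apply: eq_card => x; rewrite inE; symmetry.
by rewrite gal_kHom ?sub1v // k1AHom.
Qed.

(** * Belyi functions *)

(** With m the degree of p, the m + 1 powers f^0, ..., f^m are linearly dependent modulo p; g
    collects the coefficients of a dependency. For p = f' its roots include the critical values of
    f, with no resultant involved. *)
Lemma comp_poly_dvd (F : fieldType) (p f : {poly F}) : p != 0 ->
  exists g : {poly F}, [/\ g != 0, (size g <= size p)%N & p %| g \Po f].
Proof.
move=> p_neq0; set m := (size p).-1.
have size_p : size p = m.+1 by rewrite prednK // size_poly_gt0.
pose A : 'M[F]_(m.+1, m) := \matrix_(i < m.+1) poly_rV (f ^+ i %% p).
have : kermx A != 0.
  by rewrite -mxrank_eq0 -lt0n mxrank_ker subn_gt0 ltnS rank_leq_col.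
case/rowV0Pn => v /sub_kermxP vA0 v_neq0; exists (rVpoly v); split.
- by apply: contra v_neq0 => /eqP e; rewrite -[v]rVpolyK e linear0.
- by rewrite size_p size_poly.
suffices e : (rVpoly v \Po f) %% p = rVpoly (v *m A).
  by apply/modp_eq0P; rewrite e vA0 linear0.
rewrite (comp_polyE (rVpoly v)).
rewrite (big_ord_widen m.+1 (fun i => (rVpoly v)`_i *: f ^+ i)) ?size_poly //.
rewrite big_mkcond /= mulmx_sum_row linear_sum.
rewrite (big_morph _ (modpD p) (mod0p p)) /=.
apply: eq_bigr => i _; rewrite linearZ /= rowK poly_rV_K; last first.
  by have := ltn_modpN0 (f ^+ i) p_neq0; rewrite [X in (_ < X)%N]size_p.
rewrite coef_rVpoly_ord; case: ifP => [_|/negbT]; first by rewrite modpZl.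
rewrite -leqNgt => /(nth_default 0); rewrite coef_rVpoly_ord => ->.
by rewrite scale0r mod0p.
Qed.

Lemma deriv_neq0 (R : numDomainType) (p : {poly R}) :
  (1 < size p)%N -> p^`() != 0.
Proof.
move=> p_gt1; have : lead_coef p != 0.
  by rewrite lead_coef_eq0 -size_poly_gt0 ltnW.
rewrite lead_coefE; apply: contra => /eqP p'0.
have /eqP := coef_deriv p (size p).-2.
have p1_gt0 : (0 < (size p).-1)%N by rewrite -subn1 subn_gt0.
by rewrite p'0 coef0 prednK // eq_sym mulrn_eq0 eqn0Ngt p1_gt0.
Qed.

Lemma horner_ratr (p : {poly rat}) (r : rat) : (pC p).[ratr r] = ratr p.[r].
Proof. exact: horner_map. Qed.

Lemma critical_chain (f g : {poly rat}) (t : algC) :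
  root (pC (f \Po g)^`()) t ->
  root (pC f^`()) (pC g).[t] \/ root (pC g^`()) t.
Proof.
rewrite deriv_comp rmorphM /= map_comp_poly rootM /root horner_comp.
by case/orP; [left | right].
Qed.

(* The critical values of q are roots of some g of degree < deg q, and a
   polynomial h that works for g gives h o q for q. *)
Lemma belyi_rational_values (q : {poly rat}) : q != 0 ->
  exists g : {poly rat}, [/\ (1 < size g)%N,
    forall t, root (pC q) t -> (pC g).[t] \in Crat
    & forall t, root (pC g^`()) t -> (pC g).[t] \in Crat].
Proof.
have [n] := ubnP (size q); elim: n q => // n IHn q lt_q_n q_neq0.
have [q_le1 | q_gt1] := leqP (size q) 1.
  exists 'X; split=> [|t|t]; first by rewrite size_polyX.
    have q0 : q`_0 != 0.
      apply: contra q_neq0 => /eqP e.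
      by rewrite (size1_polyC q_le1) e.
    rewrite (size1_polyC q_le1) map_polyC /= rootC fmorph_eq0.
    by rewrite (negPf q0).
  by rewrite derivX rmorph1 /root hornerC oner_eq0.
have q'_neq0 := deriv_neq0 q_gt1.
have [g [g_neq0 g_size q'_dv]] := comp_poly_dvd q q'_neq0.
have [|h [h_gt1 h_rat h_crit]] := IHn g _ g_neq0.
  apply: leq_ltn_trans g_size _.
  by apply: leq_trans (lt_size_deriv q_neq0) _; rewrite -ltnS.
exists (h \Po q); split=> [|t|t].
- by rewrite -subn_gt0 subn1 size_comp_poly muln_gt0 -!subn1 !subn_gt0 h_gt1.
- rewrite map_comp_poly horner_comp => /eqP ->.
  by rewrite -(rmorph0 (ratr : rat -> algC)) horner_ratr Crat_rat.
rewrite map_comp_poly horner_comp => /critical_chain[]; first exact: h_crit.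
have : pC q^`() %| pC (g \Po q) by rewrite dvdp_map.
move=> /dvdpP[u e] q't; apply: h_rat.
by rewrite /root -horner_comp -map_comp_poly e hornerM (eqP q't) mulr0.
Qed.

(** Supplies the two positive exponents of the Belyi step. *)
Lemma ratio_of_pos (r : rat) : 0 < r ->
  exists m n : nat, r * n.+1%:R = m.+1%:R.
Proof.
move=> r_gt0.
have n0 : 0 < numq r by rewrite numq_gt0.
exists `|numq r|.-1, `|denq r|.-1.
rewrite !prednK ?absz_gt0 ?gt_eqF //.
by rewrite !natr_absz !ger0_norm ?denq_ge0 ?ltW // numqE.
Qed.

(** Belyi's polynomial, proportional to (X - r0)^(m+1) (r2 - X)^(n+1). The exponents are in the
    ratio (r1 - r0) : (r2 - r1), which places the only critical point outside r0 and r2 at r1; the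
    scaling gives it the value 1 there. *)
Lemma belyi_step (r0 r1 r2 : rat) : r0 < r1 -> r1 < r2 ->
  exists h : {poly rat}, [/\ (1 < size h)%N,
    [/\ h.[r0] = 0, h.[r1] = 1 & h.[r2] = 0]
    & forall t, root (pC h^`()) t -> t \in [:: ratr r0; ratr r1; ratr r2]].
Proof.
move=> lt01 lt12.
have [|m [n e]] := @ratio_of_pos ((r1 - r0) / (r2 - r1)).
  by rewrite divr_gt0 ?subr_gt0.
have n10 : r1 - r0 != 0 by rewrite subr_eq0 gt_eqF.
have n21 : r2 - r1 != 0 by rewrite subr_eq0 gt_eqF.
have {}e : (r1 - r0) * n.+1%:R = (r2 - r1) * m.+1%:R.
  by rewrite -e; field.
pose h0 : {poly rat} := ('X - r0%:P) ^+ m.+1 * (r2%:P - 'X) ^+ n.+1.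
pose c := h0.[r1].
have h0E x : h0.[x] = (x - r0) ^+ m.+1 * (r2 - x) ^+ n.+1 by rewrite !hornerE.
have c0 : c != 0 by rewrite /c h0E mulf_neq0 ?expf_neq0.
have h0' : h0^`() = (m.+1 + n.+1)%:R *:
    ((r1%:P - 'X) * ('X - r0%:P) ^+ m * (r2%:P - 'X) ^+ n).
  rewrite derivM !deriv_exp !derivB derivX !derivC /=.
  rewrite subr0 sub0r mul1r -[in RHS]mul_polyC polyC_natr natrD.
  (* r1 is the barycentre of r2 and r0 with weights m + 1 and n + 1. *)
  have /(congr1 polyC) :
      m.+1%:R * r2 + n.+1%:R * r0 = m.+1%:R * r1 + n.+1%:R * r1.
    by move: (m.+1%:R : rat) (n.+1%:R : rat) e => u v e; lra.
  rewrite !polyCD !polyCM !polyC_natr !exprS.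
  rewrite -[_ ^+ m *+ _]mulr_natr -[_ * _ *+ _]mulr_natr.
  move: r0%:P r1%:P r2%:P (m.+1%:R : {poly rat}) (n.+1%:R : {poly rat}).
  move=> R0 R1 R2 u v eq_uv.
  transitivity
    (((u * R2 + v * R0) - (u + v) * 'X) * ('X - R0) ^+ m * (R2 - 'X) ^+ n).
    by ring.
  by rewrite eq_uv; ring.
exists (c^-1 *: h0); split.
- rewrite size_scale ?invr_eq0 //.
  rewrite ltn_neqAle eq_sym size_poly_gt0 andbC.
  apply/andP; split; first by apply: contra c0 => /eqP e0; rewrite /c e0 horner0.
  apply/negP => /size_poly1P[x x0 ex].
  have := h0E r0; rewrite ex hornerC subrr exprS !mul0r => e0.
  by rewrite e0 eqxx in x0.
- rewrite !hornerZ !h0E !subrr !exprS !mul0r !mulr0 ; split=> //.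
  by rewrite -!exprS -h0E mulVf.
move=> t; rewrite derivZ h0' scalerA map_polyZ rootZ ?fmorph_eq0; last first.
  by rewrite mulf_neq0 ?invr_eq0 // pnatr_eq0.
rewrite !rmorphM !rmorphXn !rmorphB /= !map_polyC !map_polyX /= !rootM.
rewrite /root !hornerE.
rewrite !expf_eq0 !subr_eq0 !inE.
by case/orP=> [/orP[/eqP->|/andP[_ /eqP->]]|/andP[_ /eqP->]]; rewrite eqxx ?orbT.
Qed.

(** Three points of R are sent into {0, 1}, which also contains the new critical values. Replacing
    them by 0 and 1 leaves at least one point fewer. *)
Lemma belyi_rational_points (R : seq rat) :
  exists h : {poly rat}, [/\ (1 < size h)%N,
    forall r, r \in R -> h.[r] \in [:: 0; 1]
    & forall t, root (pC h^`()) t -> (pC h).[t] \in [:: 0; 1]].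
Proof.
have [n] := ubnP (size R); elim: n R => // n IHn R lt_R_n.
pose s := sort <=%R (undup R).
have s_sorted : sorted <%R s by rewrite sort_lt_sorted undup_uniq.
have s_size : (size s <= size R)%N by rewrite size_sort size_undup.
have s_mem : s =i R by move=> r; rewrite mem_sort mem_undup.
case: s => [|r0 [|r1 [|r2 s]]] /= in s_sorted s_size s_mem *.
- exists 'X; split=> [|r|t]; first by rewrite size_polyX.
    by rewrite -s_mem.
  by rewrite derivX rmorph1 /root hornerC oner_eq0.
- exists ('X - r0%:P); split=> [|r|t]; first by rewrite size_XsubC.
    by rewrite -s_mem !inE => /eqP ->; rewrite !hornerE subrr eqxx.
  by rewrite derivB derivX derivC subr0 rmorph1 /root hornerC oner_eq0.
- have lt01 : r0 < r1 by case/andP: s_sorted.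
  have n10 : r1 - r0 != 0 by rewrite subr_eq0 gt_eqF.
  exists ((r1 - r0)^-1 *: ('X - r0%:P)); split=> [|r|t].
  + by rewrite size_scale ?invr_eq0 // size_XsubC.
  + rewrite -s_mem !inE => /orP[] /eqP ->; rewrite !hornerE ?subrr ?mulr0 ?eqxx //.
    by rewrite mulVf // eqxx orbT.
  rewrite derivZ derivB derivX derivC subr0 map_polyZ rmorph1.
  by rewrite rootZ ?fmorph_eq0 ?invr_eq0 // /root hornerC oner_eq0.
case/and3P: s_sorted => lt01 lt12 _.
have [h [h_gt1 [h0 h1 h2] h_crit]] := belyi_step lt01 lt12.
(* 0 and 1 must be among the points handled by g, as they are the values of h at r0, r1, r2 and so
   at all its critical points. *)
have [|g [g_gt1 g_R g_crit]] := IHn [:: 0, 1 & map (horner h) s].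
  by rewrite /= size_map; apply: leq_trans s_size lt_R_n.
have g01 r : r \in [:: r0; r1; r2] -> g.[h.[r]] \in [:: 0; 1].
  have g0 : g.[0] \in [:: 0; 1] by apply: g_R; rewrite mem_head.
  have g1 : g.[1] \in [:: 0; 1] by apply: g_R; rewrite !inE eqxx orbT.
  by rewrite !inE in g0 g1 * => /or3P[] /eqP ->; rewrite ?h0 ?h1 ?h2.
exists (g \Po h); split=> [|r|t].
- by rewrite -subn_gt0 subn1 size_comp_poly muln_gt0 -!subn1 !subn_gt0 g_gt1.
- rewrite horner_comp -s_mem; rewrite (mem_cat r [:: r0; r1; r2] s).
  case/orP => [/g01 // | r_s]; apply: g_R.
  by rewrite !in_cons map_f ?orbT.
rewrite map_comp_poly horner_comp => /critical_chain[]; first exact: g_crit.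
move=> /h_crit t_in.
have [r r_in ->] : exists2 r, r \in [:: r0; r1; r2] & t = ratr r.
  by move: t_in; rewrite !inE => /or3P[] /eqP ->;
    [exists r0 | exists r1 | exists r2]; rewrite ?inE ?eqxx ?orbT.
have := g01 r r_in; rewrite !horner_ratr !inE.
by case/orP => /eqP ->; rewrite ?rmorph0 ?rmorph1 eqxx ?orbT.
Qed.

(** If f has critical values in {0, 1} and takes values in {0, 1} at a and 0, then (2 f - 1)^2 takes
    the value 1 at a and 0, is nonnegative on the rationals, and has only the additional critical
    value 0, where 2 f = 1. *)
Lemma belyi_polynomial (a : algC) :
  exists b : {poly rat}, [/\ (1 < size b)%N, (pC b).[a] = 1, b.[0] = 1,
    forall r, 0 <= b.[r]
    & forall t, root (pC b^`()) t -> (pC b).[t] \in [:: 0; 1]].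
Proof.
have [q [_ q_monic q_root]] := minCpolyP a.
have qa : root (pC q) a by rewrite q_root dvdpp.
have [g [g_gt1 g_rat g_crit]] := belyi_rational_values (monic_neq0 q_monic).
have [rs rsE] := closed_field_poly_normal (pC g^`()).
pose R := [:: getCrat (pC g).[a], g.[0] & [seq getCrat (pC g).[t] | t <- rs]].
have [h [h_gt1 h_R h_crit]] := belyi_rational_points R.
have h01 r : r \in Crat -> getCrat r \in R -> (pC h).[r] \in [:: 0; 1].
  move=> /getCratK {2}<- /h_R; rewrite horner_ratr !inE.
  by case/orP => /eqP ->; rewrite ?rmorph0 ?rmorph1 eqxx ?orbT.
have sq01 (K : nzRingType) (x : K) : x \in [:: 0; 1] -> (2%:R * x - 1) ^+ 2 = 1.
  rewrite !inE => /orP[] /eqP ->; first by rewrite mulr0 sub0r sqrrN expr1n.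
  by rewrite mulr1 mulr2n addrK expr1n.
pose f := h \Po g.
have f_gt1 : (1 < size f)%N.
  by rewrite -subn_gt0 subn1 size_comp_poly muln_gt0 -!subn1 !subn_gt0 h_gt1.
pose l : {poly rat} := 2%:R *: f - 1.
have l_size : size l = size f.
  rewrite size_polyDl size_scale ?pnatr_eq0 //.
  by rewrite size_polyN size_poly1.
have lE r : l.[r] = 2%:R * f.[r] - 1 by rewrite !hornerE.
have lCE r : (pC l).[r] = 2%:R * (pC f).[r] - 1.
  by rewrite rmorphB rmorph1 /= map_polyZ !hornerE rmorph_nat.
exists (l ^+ 2); split=> [||||t].
- rewrite -subn_gt0 subn1 size_exp muln_gt0 andbT -subn1 subn_gt0 l_size //.
- rewrite rmorphXn /= horner_exp lCE; apply: sq01; rewrite map_comp_poly horner_comp.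
  by apply: h01; rewrite ?g_rat // mem_head.
- rewrite horner_exp lE; apply: sq01; rewrite horner_comp.
  by apply: h_R; rewrite !inE eqxx orbT.
- by move=> r; rewrite horner_exp sqr_ge0.
rewrite deriv_exp rmorphMn /= -mulr_natr -polyC_natr mulrC mul_polyC.
rewrite rootZ ?pnatr_eq0 // rmorphM /= rootM expr1 !rmorphXn /= horner_exp.
case/orP => [|/eqP ->]; last by rewrite expr0n mem_head.
rewrite derivB derivZ derivC subr0 map_polyZ rootZ ?fmorph_eq0 ?pnatr_eq0 //.
move=> /critical_chain f't; rewrite lCE.
suffices /sq01 -> : (pC f).[t] \in [:: 0; 1] by rewrite !inE eqxx orbT.
rewrite map_comp_poly horner_comp; case: f't => [/h_crit // | g't].
apply: h01; first exact: g_crit.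
rewrite !inE; apply/orP; right; apply/orP; right; apply/mapP; exists t => //.
rewrite -root_prod_XsubC; move: g't; rewrite rsE rootZ // lead_coef_eq0.
by rewrite map_poly_eq0 deriv_neq0.
Qed.

Lemma nonroot_natr (R : numDomainType) (p : {poly R}) : p != 0 ->
  exists k : nat, ~~ root p k%:R.
Proof.
move=> p_neq0; apply: NNPP => no_k.
have all_root : all (root p) [seq i%:R | i <- iota 0 (size p)].
  apply/allP => _ /mapP[i _ ->]; apply/negPn/negP => ri.
  by apply: no_k; exists i.
have uniq_s : uniq [seq i%:R : R | i <- iota 0 (size p)].
  by rewrite map_inj_uniq ?iota_uniq // => i j /eqP; rewrite eqr_nat => /eqP.
have := max_poly_roots p_neq0 all_root uniq_s.
by rewrite size_map size_iota ltnn.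
Qed.

(* If d clears the denominators of b then b takes integer values on d Z. *)
Lemma nonneg_poly_integer_value (b : {poly rat}) :
  (1 < size b)%N -> b.[0] = 1 -> (forall r, 0 <= b.[r]) ->
  exists c k, b.[c] = k.+2%:R.
Proof.
move=> b_gt1 b0 b_ge0; have [q [d d_neq0 def_b]] := rat_poly_scale b.
have d0 : d%:~R != 0 :> rat by rewrite intr_eq0.
have bE (z : int) : b.[z%:~R] = d%:~R^-1 * q.[z]%:~R.
  by rewrite def_b hornerZ horner_map.
have int_val (k : int) : exists z : int, b.[(d * k)%:~R] = z%:~R.
  have /factor_theorem[q1 def_q] : root (q - q.[0]%:P) 0.
    by rewrite /root !hornerE subrr.
  have qE : q.[d * k] = q1.[d * k] * (d * k) + q.[0].
    have := congr1 (horner^~ (d * k)) def_q; rewrite !hornerE => <-.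
    by rewrite subrK.
  exists (q1.[d * k] * k + 1).
  rewrite bE qE !rmorphD !rmorphM /= rmorph1 mulrDr -bE b0.
  by congr (_ + 1); field.
(* A natural number outside the finitely many roots of f gives a value of b other than 0 and 1;
   being a nonnegative integer, it is at least 2. *)
pose f := (b * (b - 1)) \Po (d%:~R *: 'X).
have f_neq0 : f != 0.
  rewrite -size_poly_gt0 size_comp_poly2 ?size_poly_gt0; last first.
    by rewrite size_scale ?size_polyX.
  have b_neq0 : b != 0 by rewrite -size_poly_gt0 ltnW.
  rewrite mulf_neq0 // subr_eq0; apply: contraTneq b_gt1 => ->.
  by rewrite size_poly1.
have [k] := nonroot_natr f_neq0.
rewrite /root horner_comp !hornerE mulf_eq0 subr_eq0.
rewrite -[k%:R]/(Posz k)%:~R -rmorphM /=.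
have [z bz] := int_val k; rewrite bz => /norP[z0 z1].
have : 0 <= z by rewrite -(ler0z rat) -bz.
case: z bz z0 z1 => [[|[|j]]|j] // bz z0 z1 _.
by exists (d * k)%:~R, j.
Qed.

Section ReversedPolynomial.

Variables (F : fieldType) (n : nat).
Implicit Types (f : {poly F}) (s : F).

(** The reciprocal polynomial s^n f(1/s), for a bound n on the degree: the change of coordinate
    between s and 1/s. *)
Definition rev_poly f : {poly F} := \sum_(j < n.+1) f`_j *: 'X^(n - j).

Lemma coef_rev_poly f i : (i <= n)%N -> (rev_poly f)`_i = f`_(n - i).
Proof.
move=> le_in; rewrite coef_sum (bigD1 (inord (n - i))) //= big1 ?addr0.
  by rewrite coefZ coefXn inordK ?ltnS ?leq_subr // subKn // eqxx mulr1.
move=> j; rewrite -val_eqE /= inordK ?ltnS ?leq_subr // => neq_j.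
rewrite coefZ coefXn; case: eqP => [def_i | _]; last by rewrite mulr0.
by case/eqP: neq_j; rewrite def_i subKn // -ltnS.
Qed.

Lemma size_rev_poly f : (size (rev_poly f) <= n.+1)%N.
Proof.
apply: leq_trans (size_sum _ _ _) _; apply/bigmax_leqP => j _.
by rewrite (leq_trans (size_scale_leq _ _)) // size_polyXn ltnS leq_subr.
Qed.

Lemma horner_rev_poly f s : s != 0 -> (size f <= n.+1)%N ->
  (rev_poly f).[s] = s ^+ n * f.[s^-1].
Proof.
move=> s_neq0 size_f; rewrite (horner_coef_wide _ size_f) mulr_sumr horner_sum.
apply: eq_bigr => j _; rewrite hornerZ hornerXn mulrCA exprVn.
by rewrite -expfB_cond // (negPf s_neq0) /= add0n -ltnS.
Qed.

(** The derivative of s^n f(1/s), multiplied by s so that n times the polynomial itself splits off;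
    this is the shape n u - w of [double_root_homogeneous]. *)
Lemma deriv_rev_poly f s : s != 0 -> (size f <= n.+1)%N ->
  s * (rev_poly f)^`().[s]
  = n%:R * (rev_poly f).[s] - s ^+ n * s^-1 * f^`().[s^-1].
Proof.
move=> s_neq0 size_f.
have -> : f^`() = \sum_(j < n.+1) f`_j *: ('X^(j.-1) *+ j).
  have {1}-> : f = \sum_(j < n.+1) f`_j *: 'X^j.
    rewrite -poly_def; apply/polyP => i; rewrite coef_poly.
    by case: ltnP => // /(leq_trans size_f) /(nth_default 0).
  by rewrite raddf_sum; apply: eq_bigr => j _; rewrite /= derivZ derivXn.
rewrite raddf_sum /= !horner_sum !mulr_sumr -sumrB; apply: eq_bigr => j _.
have le_jn : (j <= n)%N by rewrite -ltnS.
rewrite derivZ derivXn !hornerZ !hornerMn !hornerXn exprVn.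
have -> : n%:R = (n - j)%:R + j%:R :> F by rewrite -natrD subnK.
have e1 : s * (s ^+ (n - j).-1 *+ (n - j)) = s ^+ (n - j) * (n - j)%:R.
  case: (n - j)%N => [|m]; first by rewrite mulr0n !mulr0.
  by rewrite -mulr_natr mulrA -exprS.
have e2 : s ^+ n * s^-1 * (s ^- j.-1 *+ j) = s ^+ (n - j) * j%:R.
  case: (nat_of_ord j) le_jn => [|m] lt_mn; first by rewrite mulr0n !mulr0.
  rewrite -[_ *+ _]mulr_natr mulrA; congr (_ * _).
  by rewrite -mulrA -invfM -exprS -expfB_cond // (negPf s_neq0) /= add0n.
rewrite mulrCA e1 [X in _ - X]mulrCA e2; ring.
Qed.

End ReversedPolynomial.

Lemma map_rev_poly (F K : fieldType) (phi : {rmorphism F -> K}) n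
    (f : {poly F}) :
  map_poly phi (rev_poly n f) = rev_poly n (map_poly phi f).
Proof.
rewrite rmorph_sum; apply: eq_bigr => j _ /=.
by rewrite map_polyZ map_polyXn coef_map.
Qed.

(* With u = v beta the first hypothesis is the equation h(beta) = al for
   h(y) = (y - 1)^(k+2) / (y^(k+1) (y - (k+2))), whose logarithmic derivative is
   - (k+2)(k+1) / (y (y - 1) (y - (k+2))): h has no critical value but 0, 1, oo. *)
Lemma double_root_homogeneous (F : numFieldType) (k : nat) (al u v n w : F) :
  al != 0 -> v != 0 ->
  (u - v) ^+ k.+2 - al * (u ^+ k.+1 * (u - k.+2%:R * v)) = 0 ->
  k.+2%:R * (u - v) ^+ k.+1 * (n * (u - v) - w)
    - al * (k.+1%:R * u ^+ k * (n * u - w) * (u - k.+2%:R * v)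
            + u ^+ k.+1 * (n * u - w - k.+2%:R * (n * v))) = 0 ->
  w = 0.
Proof.
move=> al0 v0 e1 e2; apply/eqP/negPn/negP => w0.
have k2 : k.+2%:R != 0 :> F by rewrite pnatr_eq0.
have k1 : k.+1%:R != 0 :> F by rewrite pnatr_eq0.
have eK : k.+2%:R = k.+1%:R + 1 :> F by rewrite -natr1.
(* [e1] is homogeneous of degree k + 2 in u and v, so n (k + 2) times [e1] minus [e2] is free of n:
   it is (k + 2) w times the left side here. *)
have eH : (u - v) ^+ k.+1 - al * u ^+ k * (u - k.+1%:R * v) = 0.
  apply: (mulfI w0); apply: (mulfI k2); rewrite !mulr0.
  apply: (@etrans _ _ (n * k.+2%:R * 0 - 0)); last by rewrite mulr0 subr0.
  rewrite -{2}e2 -[in X in _ * X - _]e1 eK !exprS; ring.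
(* This is [e1] minus (u - v) times [eH]. *)
have : al * k.+1%:R * u ^+ k * v ^+ 2 = 0.
  apply: (@etrans _ _ (0 - (u - v) * 0)); last by rewrite mulr0 subr0.
  rewrite -{1}e1 -eH eK !exprS; ring.
move/eqP; rewrite !mulf_eq0 (negPf al0) (negPf k1) !expf_eq0 (negPf v0) /= orbF.
case/andP => _ /eqP u0; move: e1 => /eqP.
rewrite u0 [0 ^+ _]exprS !mul0r mulr0 subr0 sub0r expf_eq0 /=.
by rewrite oppr_eq0 (negPf v0).
Qed.

Lemma horner_deriv_homogeneous (F : fieldType) (k : nat) (al s : F)
    (R V : {poly F}) (u := R.[s]) (v := V.[s]) (u' := R^`().[s]) (v' := V^`().[s]) :
  ((R - V) ^+ k.+2 - al *: (R ^+ k.+1 * (R - k.+2%:R *: V)))^`().[s]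
  = k.+2%:R * (u - v) ^+ k.+1 * (u' - v')
    - al * (k.+1%:R * u ^+ k * u' * (u - k.+2%:R * v)
            + u ^+ k.+1 * (u' - k.+2%:R * v')).
Proof.
rewrite derivB derivZ deriv_exp [(_ * _)^`()]derivM deriv_exp !derivB derivZ /=.
rewrite -(mulr_natl _ k.+2) -(mulr_natl _ k.+1).
rewrite -[k.+2%:R]polyC_natr -[k.+1%:R]polyC_natr.
rewrite !hornerD !hornerN !hornerZ !hornerD !hornerM !hornerC.
rewrite !horner_exp !hornerD !hornerN !hornerZ -/u -/v -/u' -/v'; ring.
Qed.

(* If b is a Belyi polynomial with b(a) = 1 and b(c) = k + 2 an integer, then
   s |-> h(b(c + 1/s)), with h as in double_root_homogeneous, has a simple pole
   at s = oo; P and Q are its numerator and denominator. *)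
Lemma belyi_fraction (a : algC) :
  exists (c : rat) (P Q : {poly rat}),
    [/\ a != ratr c, size P = (size Q).+1,
        forall s, root (pC P) s -> ~~ root (pC Q) s,
        root (pC P) (a - ratr c)^-1
      & forall al s, al != 0 -> al != 1 -> root (pC P - al *: pC Q) s ->
          ~~ root (pC P - al *: pC Q)^`() s].
Proof.
have [b0 [b0_gt1 b0a b00 b0_ge0 b0_crit]] := belyi_polynomial a.
have [c [k b0c]] := nonneg_poly_integer_value b0_gt1 b00 b0_ge0.
pose b := b0 \Po ('X + c%:P).
have size_b : size b = size b0 by rewrite size_comp_poly2 // size_XaddC.
have bE t : (pC b).[t] = (pC b0).[t + ratr c].
  by rewrite map_comp_poly horner_comp rmorphD /= map_polyX map_polyC !hornerE.
have b_crit t : root (pC b^`()) t -> (pC b).[t] \in [:: 0; 1].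
  case/critical_chain; last first.
    by rewrite derivD derivX derivC addr0 rmorph1 /root hornerC oner_eq0.
  by move/b0_crit; rewrite bE rmorphD /= map_polyX map_polyC !hornerE.
have b_0 : b.[0] = k.+2%:R by rewrite horner_comp !hornerE.
have ba : (pC b).[a - ratr c] = 1 by rewrite bE subrK.
pose n := (size b).-1.
have size_bn : size b = n.+1 by rewrite prednK // size_b ltnW.
have n_gt0 : (0 < n)%N by rewrite -ltnS -size_bn size_b.
pose r := rev_poly n b.
have r0 : (pC r).[0] != 0.
  rewrite horner_coef0 coef_map fmorph_eq0 coef_rev_poly // subn0.
  by rewrite -lead_coefE lead_coef_eq0 -size_poly_eq0 size_bn.
have rn : r`_n = k.+2%:R by rewrite coef_rev_poly // subnn -horner_coef0.
(* b(0) = k + 2 is neither 0 nor 1, so 0 is not a critical point of b. *)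
have b1 : b`_1 != 0.
  apply/negP => /eqP b1; have /b_crit : root (pC b^`()) 0.
    by rewrite /root horner_coef0 coef_map coef_deriv b1 mul0rn fmorph_eq0.
  rewrite -(rmorph0 (ratr : rat -> algC)) horner_ratr b_0 rmorph_nat !inE.
  by rewrite rmorph0 pnatr_eq0 (eqr_nat _ k.+2 1).
have size_X m : (size (m *: 'X^n : {poly rat}) <= n.+1)%N.
  by rewrite (leq_trans (size_scale_leq _ _)) // size_polyXn.
have size_max (p : {poly rat}) m :
    (size p <= m.+1)%N -> p`_m != 0 -> size p = m.+1.
  move=> le_p pm; apply/eqP; rewrite eqn_leq le_p ltnNge; apply: contra pm.
  by move/(nth_default 0) => ->.
have size_r : size r = n.+1.
  by apply: size_max; rewrite ?size_rev_poly ?rn ?pnatr_eq0.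
have size_B m (p := r - m *: 'X^n) : (size p <= n.+1)%N.
  by rewrite (leq_trans (size_polyD _ _)) // size_polyN geq_max size_r leqnn size_X.
have size_P : size (r - 1 *: 'X^n) = n.+1.
  apply: size_max => //; rewrite coefB coefZ coefXn eqxx mulr1 rn.
  by rewrite subr_eq0 (eqr_nat _ k.+2 1).
(* The leading coefficient k + 2 cancels and the next one is b_1, so the degree drops by exactly
   one: the pole at s = oo is simple. *)
have size_Q : size (r - k.+2%:R *: 'X^n) = n.
  rewrite -[in RHS](prednK n_gt0); apply: size_max.
    rewrite prednK //; apply/leq_sizeP => j.
    rewrite leq_eqVlt => /orP[/eqP <-|lt_nj].
      by rewrite coefB coefZ coefXn eqxx mulr1 rn subrr.
    by rewrite nth_default // (leq_trans (size_B _)).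
  rewrite coefB coefZ coefXn coef_rev_poly ?leq_pred //.
  by rewrite -{1}(prednK n_gt0) subSnn ltn_eqF ?prednK // mulr0 subr0.
pose P := (r - 1 *: 'X^n) ^+ k.+2; pose Q := r ^+ k.+1 * (r - k.+2%:R *: 'X^n).
have PE s : (pC P).[s] = ((pC r).[s] - s ^+ n) ^+ k.+2.
  by rewrite rmorphXn rmorphB /= map_polyZ map_polyXn !hornerE rmorph1 mul1r.
have QE s : (pC Q).[s] = (pC r).[s] ^+ k.+1 * ((pC r).[s] - k.+2%:R * s ^+ n).
  by rewrite rmorphM rmorphXn rmorphB /= map_polyZ map_polyXn !hornerE rmorph_nat.
have rE s : s != 0 -> (pC r).[s] = s ^+ n * (pC b).[s^-1].
  by move=> s0; rewrite map_rev_poly horner_rev_poly // size_map_poly size_bn.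
have kk : 1 - k.+2%:R != 0 :> algC by rewrite subr_eq0 eq_sym (eqr_nat _ k.+2 1).
have a_neq_c : a - ratr c != 0.
  apply: contraTneq isT => e0; move: ba; rewrite e0.
  rewrite -(rmorph0 (ratr : rat -> algC)) horner_ratr b_0 rmorph_nat => /eqP.
  by rewrite (eqr_nat _ k.+2 1).
exists c, P, Q; split.
- by rewrite -subr_eq0.
- have size_X_n (p : {poly rat}) m : size p = n.+1 -> size (p ^+ m) = (n * m).+1.
    move=> size_p; have p0 : p != 0 by rewrite -size_poly_eq0 size_p.
    by rewrite -[LHS]prednK ?size_poly_gt0 ?expf_neq0 // size_exp size_p.
  rewrite /P /Q size_X_n //.
  rewrite size_mul ?expf_neq0 -?size_poly_eq0 ?size_r ?size_Q -?lt0n //.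
  by rewrite size_X_n // addSn /= addnC -mulnS.
- move=> s; rewrite /root PE QE expf_eq0 /= subr_eq0 => /eqP u_eq.
  have s0 : s != 0.
    by apply: contraNneq r0 => s0; rewrite -{1}s0 u_eq s0 expr0n gtn_eqF.
  rewrite u_eq mulf_neq0 ?expf_neq0 // -{1}[s ^+ n]mul1r -mulrBl.
  by rewrite mulf_neq0 ?expf_neq0.
- rewrite /root PE rE ?invr_eq0 // invrK ba mulr1 subrr expf_eq0 /= eqxx //.
move=> al s al0 al1; rewrite /root hornerD hornerN hornerZ PE QE => /eqP e1.
set u := (pC r).[s] in e1; set v := s ^+ n in e1.
(* At s = 0 the argument 1/s of b is oo, where h o b has the value h(oo) = 1; hence al != 1 excludes
   it. *)
have s0 : s != 0.
  apply: contraNneq r0 => s0; move: e1.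
  rewrite /v /u s0 expr0n gtn_eqF // mulr0 !subr0.
  move/eqP; rewrite -exprSr -[X in X - _]mul1r -mulrBl mulf_eq0 expf_eq0 /=.
  by rewrite subr_eq0 eq_sym (negPf al1).
have v0 : v != 0 by rewrite expf_neq0.
apply/negP => /eqP e2.
(* The part of s r'(s) that comes from the derivative of b; it vanishes only where b'(1/s) does. *)
pose w := v * s^-1 * (pC b)^`().[s^-1].
have ru : s * (pC r)^`().[s] = n%:R * u - w.
  by rewrite /u map_rev_poly deriv_rev_poly // size_map_poly size_bn.
have rv : s * ('X^n)^`().[s] = n%:R * v.
  rewrite derivXn hornerMn hornerXn /v -mulr_natr mulrA -exprS prednK //.
  by rewrite mulrC.
have w0 : w = 0.
  apply: (double_root_homogeneous al0 v0 e1 (n := n%:R)).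
  apply: (@etrans _ _ (s * 0)); last by rewrite mulr0.
  rewrite -e2 /P rmorphXn /Q rmorphM rmorphXn !rmorphB /= !map_polyZ !map_polyXn.
  rewrite rmorph1 rmorph_nat scale1r horner_deriv_homogeneous -/u hornerXn -/v.
  have {1}-> : n%:R * (u - v) - w = s * ((pC r)^`().[s] - 'X^n^`().[s]).
    by rewrite [s * _]mulrBr ru rv; ring.
  rewrite -ru -rv; ring.
have : (pC b)^`().[s^-1] = 0.
  by move/eqP: w0; rewrite !mulf_eq0 invr_eq0 (negPf v0) (negPf s0) => /eqP.
rewrite deriv_map => /eqP /b_crit.
(* At a critical point b(1/s) is 0 or 1. Then [e1] forces v^(k+2) = 0 in the first case and al (1 -
   (k + 2)) v^(k+2) = 0 in the second. *)
move: e1; rewrite /u rE // -/v !inE => e1 /orP[] /eqP e; move/eqP: e1; rewrite e.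
  rewrite mulr0 [0 ^+ _]exprS !mul0r mulr0 subr0 sub0r expf_eq0 /=.
  by rewrite oppr_eq0 (negPf v0).
rewrite mulr1 subrr expr0n sub0r oppr_eq0 !mulf_eq0 (negPf al0).
rewrite expf_eq0 (negPf v0) andbF.
by rewrite -{1}[v]mul1r -mulrBl mulf_eq0 (negPf kk) (negPf v0).
Qed.

(** * Unramified extensions of Qbar(x) *)

Section Embeddings.

Variable L : fieldExtType Qbarx.

Definition embX (A : {poly algC}) : L := (FracField.tofrac A)%:A.
HB.instance Definition _ := GRing.RMorphism.copy embX
  (in_alg L \o @FracField.tofrac {poly algC}).

Definition embC (c : algC) : L := embX c%:P.
HB.instance Definition _ := GRing.RMorphism.copy embC (embX \o polyC).

Lemma embX_horner A : embX A = (map_poly embC A).[embX 'X].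
Proof.
elim/poly_ind: A => [|A c IHA]; first by rewrite !rmorph0 horner0.
rewrite !rmorphD !rmorphM /= map_polyX map_polyC !hornerE -IHA.
by [].
Qed.

Lemma embX_inj : injective embX.
Proof.
by move=> A B /(fmorph_inj (in_alg L)) /eqP; rewrite tofrac_eq => /eqP.
Qed.

Lemma embX_eq0 A : (embX A == 0) = (A == 0).
Proof. by rewrite -(inj_eq embX_inj) rmorph0. Qed.

End Embeddings.

Arguments embX L A : clear implicits.
Arguments embC L c : clear implicits.

(** L is finite over F, so the generated field consists of polynomials in [rs], and stability under
    sums and products is enough. *)
Lemma adjoin_seq_ind (F : fieldType) (L : fieldExtType F) (P : L -> Prop)
    (rs : seq L) :
  (forall k, P k%:A) -> (forall x y, P x -> P y -> P (x + y)) ->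
  (forall x y, P x -> P y -> P (x * y)) -> (forall r, r \in rs -> P r) ->
  forall x, x \in <<1 & rs>>%VS -> P x.
Proof.
move=> P_K P_D P_M; elim/last_ind: rs => [|rs r IHrs] P_rs x.
  by rewrite adjoin_nil subfield_closed => /vlineP[k ->].
rewrite adjoin_rcons => /Fadjoin_polyP[p p_rs ->].
have Prs y : y \in <<1 & rs>>%VS -> P y.
  by apply: IHrs => s s_rs; apply: P_rs; rewrite mem_rcons inE s_rs orbT.
have Pr : P r by apply: P_rs; rewrite mem_rcons mem_head.
have P0 : P 0 by rewrite -[0](scale0r 1); apply: P_K.
have P1 : P 1 by rewrite -[1](scale1r 1); apply: P_K.
rewrite horner_coef; elim/big_rec: _ => // i y _ Py; apply: P_D => //.
apply: (P_M); first by apply: Prs; apply: (polyOverP p_rs).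
by elim: (nat_of_ord i) => [|j IHj]; rewrite ?expr0 // exprS; apply: P_M.
Qed.

(** * Discrete valuations and approximation of algebraic functions *)

Section Valuation.

Variables (L : fieldExtType Qbarx) (w : L -> int).
Hypothesis dv : discrete_valuation w.
Implicit Types (g h : L) (N : int).

Local Notation wM := (valuationM dv).

(* N <= w g, where w 0 = +oo. *)
Definition vge g N := (g == 0) || (N <= w g).

Lemma valuation1 : w 1 = 0.
Proof.
have := valuation_const dv (oner_neq0 _).
by rewrite (_ : (ratC 1)%:A = 1 :> L) // /ratC !rmorph1 scale1r.
Qed.

Lemma valuationN g : w (- g) = w g.
Proof.
have [-> | g0] := eqVneq g 0; first by rewrite oppr0.
have N1 : (-1 : L) != 0 by rewrite oppr_eq0 oner_eq0.
have wN1 : w (-1) = 0.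
  rewrite -[RHS](valuation_const dv (_ : (-1 : algC) != 0)) ?oppr_eq0 ?oner_eq0 //.
  by congr w; rewrite /ratC !rmorphN !rmorph1 scaleN1r.
by rewrite -mulN1r wM // wN1 add0r.
Qed.

Lemma valuationX g n : g != 0 -> w (g ^+ n) = w g *+ n.
Proof.
move=> g0; elim: n => [|n IHn]; first by rewrite expr0 valuation1 mulr0n.
by rewrite exprS wM ?expf_neq0 // IHn mulrS.
Qed.

Lemma vge0 N : vge 0 N. Proof. by rewrite /vge eqxx. Qed.

Lemma vge_le g M N : N <= M -> vge g M -> vge g N.
Proof.
by rewrite /vge => le_NM /orP[-> // | /(le_trans le_NM) ->]; rewrite orbT.
Qed.

Lemma vgeN g N : vge (- g) N = vge g N.
Proof. by rewrite /vge oppr_eq0 valuationN. Qed.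

Lemma vgeD g h N : vge g N -> vge h N -> vge (g + h) N.
Proof.
rewrite /vge; have [-> | g0 /= Ng] := eqVneq g 0; first by rewrite add0r.
have [-> | h0 /= Nh] := eqVneq h 0; first by rewrite addr0 (negPf g0) Ng.
have [// | gh0 /=] := eqVneq (g + h) 0.
by apply: le_trans (valuationD dv g0 h0 gh0); rewrite le_min Ng.
Qed.

Lemma vgeB g h N : vge g N -> vge h N -> vge (g - h) N.
Proof. by move=> Ng Nh; apply: vgeD; rewrite ?vgeN. Qed.

Lemma vgeM g h M N : vge g M -> vge h N -> vge (g * h) (M + N).
Proof.
rewrite /vge; have [-> | g0 /= Mg] := eqVneq g 0; first by rewrite mul0r eqxx.
have [-> | h0 /= Nh] := eqVneq h 0; first by rewrite mulr0 eqxx.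
by rewrite mulf_eq0 (negPf g0) (negPf h0) /= wM // lerD.
Qed.

Lemma vgeM0 g h N : vge g 0 -> vge h N -> vge (g * h) N.
Proof. by move=> g0 /(vgeM g0); rewrite add0r. Qed.

Lemma vge_sum (I : Type) (r : seq I) (P : pred I) (G : I -> L) N :
  (forall i, P i -> vge (G i) N) -> vge (\sum_(i <- r | P i) G i) N.
Proof.
move=> NG; elim/big_rec: _ => [|i g Pi Ng]; first exact: vge0.
by apply: vgeD; rewrite ?NG.
Qed.

Lemma vge_exists g : exists N : nat, vge g (- N%:Z).
Proof.
exists `|w g|%N; rewrite /vge; apply/orP; right.
by rewrite abszE lerNl -normrN ler_norm.
Qed.

Lemma valuation_dominant g h N : g != 0 -> w g < N -> vge h N ->
  g + h != 0 /\ w (g + h) = w g.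
Proof.
rewrite /vge => g0 lt_N.
have [-> | h0 /= Nh] := eqVneq h 0; first by rewrite addr0.
have lt_gh := lt_le_trans lt_N Nh.
have gh0 : g + h != 0.
  apply: contraTneq lt_gh => /eqP; rewrite addr_eq0 => /eqP ->.
  by rewrite valuationN ltxx.
split=> //; apply/le_anti/andP; split; last first.
  by apply: le_trans (valuationD dv g0 h0 gh0); rewrite le_min lexx ltW.
rewrite leNgt; apply/negP => lt_g.
have Nh0 : - h != 0 by rewrite oppr_eq0.
have := valuationD dv gh0 Nh0; rewrite addrK => /(_ g0).
by rewrite ge_min valuationN !leNgt lt_g lt_gh.
Qed.

Lemma vge_integral (f : {poly L}) y : (forall i, vge f`_i 0) ->
  lead_coef f != 0 -> w (lead_coef f) = 0 -> root f y -> vge y 0.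
Proof.
move=> f_ge lc0 w_lc fy; rewrite /vge; have [//| y0 /=] := eqVneq y 0.
rewrite leNgt; apply/negP => wy.
have f0 : f != 0 by rewrite -lead_coef_eq0.
set d := (size f).-1; have size_f : size f = d.+1 by rewrite prednK ?size_poly_gt0.
(* The equation f(y) = 0 divided by y^d: if w y < 0, every term on the right has positive value, but
   the leading coefficient is a unit. *)
have e : lead_coef f = - \sum_(i < d) f`_i * y^-1 ^+ (d - i).
  apply/eqP; rewrite -addr_eq0; apply/eqP.
  apply: (mulfI (expf_neq0 d y0)); rewrite mulr0 -[RHS](eqP fy) horner_coef size_f.
  rewrite big_ord_recr /= mulrDr addrC mulr_sumr.
  congr (_ + _); first by rewrite mulrC.
  apply: eq_bigr => i _; rewrite mulrCA; congr (_ * _).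
  by rewrite exprVn -expfB_cond ?(negPf y0) ?leq_subr // subKn // ltnW.
have : vge (lead_coef f) 1.
  rewrite e vgeN; apply: vge_sum => i _; apply: vgeM0; first exact: f_ge.
  rewrite /vge expf_eq0 invr_eq0 (negPf y0) andbF /= valuationX ?invr_eq0 //.
  have wyV : 0 < w y^-1.
    have yV0 : y^-1 != 0 by rewrite invr_eq0.
    by have := wM y0 yV0; rewrite mulfV // valuation1; lia.
  have : (0 < d - i)%N by rewrite subn_gt0.
  case: (d - i)%N => // n _; rewrite mulrS -[1]addr0; apply: lerD; first by lia.
  by rewrite mulrn_wge0 // ltW.
by rewrite /vge (negPf lc0) w_lc.
Qed.

Variable al : algC.
Hypothesis w_al : 0 < w (ratX - ratC al)%:A.

Local Notation emb := (embX L).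
Local Notation cst := (embC L).
Local Notation e := (w (ratX - ratC al)%:A).
Local Notation pi := (emb ('X - al%:P)).

Let pi_e : w pi = e.
Proof. by rewrite /embX rmorphB. Qed.

Let pi_neq0 : pi != 0.
Proof. by rewrite embX_eq0 polyXsubC_eq0. Qed.

Let vge_pi : vge pi e.
Proof. by rewrite /vge pi_e lexx orbT. Qed.

Lemma valuation_cst c : c != 0 -> w (cst c) = 0.
Proof. exact: (valuation_const dv). Qed.

Lemma vge_cst c : vge (cst c) 0.
Proof.
rewrite /vge; have [-> | c0] := eqVneq c 0; first by rewrite rmorph0 eqxx.
by rewrite valuation_cst // lexx orbT.
Qed.

Lemma vge_emb A : vge (emb A) 0.
Proof.
elim/poly_ind: A => [|A c IHA]; first by rewrite rmorph0 vge0.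
rewrite -['X](subrK al%:P) mulrDr !rmorphD !rmorphM /=.
rewrite !vgeD ?vge_cst // mulrC vgeM0 ?vge_cst //.
by apply: (vge_le (ltW w_al)).
Qed.

Lemma vge_emb_root A : root A al -> vge (emb A) e.
Proof. by move=> /factor_theorem[B ->]; rewrite rmorphM /= vgeM0 // vge_emb. Qed.

Lemma valuation_emb_nonroot A : ~~ root A al -> w (emb A) = 0.
Proof.
move=> Aal; have rB : root (A - A.[al]%:P) al by rewrite /root !hornerE subrr.
rewrite -[A](subrK A.[al]%:P) rmorphD addrC /=.
have cA : w (cst A.[al]) = 0 by rewrite valuation_cst.
rewrite -[RHS]cA; apply: (valuation_dominant _ _ (vge_emb_root rB)).2.
  by rewrite embX_eq0 polyC_eq0.
by rewrite [w _]cA.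
Qed.

(** On Qbar(x), w is e times the order at x = al: split off the power of X - al from numerator and
    denominator. *)
Lemma valuation_scalar k : k != 0 -> exists m : int, w k%:A = m * e.
Proof.
have polyc (A : {poly algC}) : A != 0 -> exists m : int, w (emb A) = m * e.
  move=> A0; have [m [B]] := multiplicity_XsubC A al; rewrite A0 /= => Bal ->.
  have B0 : emb B != 0.
    by rewrite embX_eq0; apply: contraNneq Bal => ->; rewrite root0.
  exists m; rewrite rmorphM rmorphXn wM ?expf_neq0 //.
  rewrite valuation_emb_nonroot // add0r.
  by rewrite valuationX // pi_e -mulr_natl natz.
move=> k0; have d0 := denom_ratioP (repr k); have def_k := fracE k.
have n0 : \n_(repr k) != 0.
  by apply: contraNneq k0 => n0; rewrite def_k n0 rmorph0 mul0r.
have [i ei] := polyc _ n0; have [j ej] := polyc _ d0; exists (i - j).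
have kA0 : k%:A != 0 :> L by rewrite scaler_eq0 (negPf k0) oner_eq0.
have dA0 : emb \d_(repr k) != 0 by rewrite embX_eq0.
have dF0 : FracField.tofrac \d_(repr k) != 0 by rewrite tofrac_eq0.
have kd : k%:A * emb \d_(repr k) = emb \n_(repr k).
  have kF : k * FracField.tofrac \d_(repr k) = FracField.tofrac \n_(repr k).
    by rewrite {1}def_k mulfVK.
  by rewrite [RHS]/embX -kF -scalerA mulr_algl.
by rewrite mulrBl -ei -ej -kd wM // addrK.
Qed.

Lemma vge_horner (h : {poly algC}) y : vge y 0 -> vge (map_poly cst h).[y] 0.
Proof.
move=> y0; elim/poly_ind: h => [|h c IHh]; first by rewrite rmorph0 horner0 vge0.
rewrite rmorphD rmorphM /= map_polyX map_polyC !hornerE.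
by rewrite vgeD ?vge_cst // vgeM0.
Qed.

Lemma vge_horner_root (h : {poly algC}) y c N : vge (y - cst c) N -> vge y 0 ->
  root h c -> vge (map_poly cst h).[y] N.
Proof.
move=> yc y0 /factor_theorem[g ->].
rewrite rmorphM /= map_polyXsubC hornerM hornerXsubC vgeM0 //.
exact: vge_horner.
Qed.

Lemma taylor2 (h : {poly algC}) y z : vge y 0 -> vge z 0 -> exists2 r, vge r 0 &
  (map_poly cst h).[z] - (map_poly cst h).[y]
  = (z - y) * (map_poly cst h^`()).[y] + (z - y) ^+ 2 * r.
Proof.
move=> y0 z0; elim/poly_ind: h => [|h c [r r0 IHh]].
  by exists 0; rewrite ?vge0 // deriv0 rmorph0 !horner0; ring.
exists ((map_poly cst h^`()).[y] + r * z).
  by rewrite vgeD ?vge_horner // vgeM0.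
rewrite derivD derivM derivX derivC mulr1 addr0 !rmorphD !rmorphM /=.
rewrite map_polyX map_polyC !hornerE.
apply: (@etrans _ _ (((map_poly cst h).[z] - (map_poly cst h).[y]) * z
   + (map_poly cst h).[y] * (z - y))); first by ring.
by rewrite IHh; ring.
Qed.

Section Root.

Variables (p q : {poly algC}) (y : L).
Hypothesis size_pq : (size q < size p)%N.
Hypothesis simple_pq :
  forall s, root (p - al *: q) s -> ~~ root (p - al *: q)^`() s.
Hypothesis y_root : (map_poly cst p).[y] = emb 'X * (map_poly cst q).[y].

Local Notation G := (p - al *: q).

(** As deg q < deg p, the leading coefficient of p - x q is a constant, so y is integral over
    Qbar[x]. *)
Lemma root_integral : vge y 0.
Proof.
pose f := map_poly cst p - emb 'X *: map_poly cst q.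
have lc_f : lead_coef f = cst (lead_coef p).
  rewrite lead_coefDl ?lead_coef_map // size_polyN.
  by rewrite (leq_ltn_trans (size_scale_leq _ _)) // !size_map_poly.
have p0 : p != 0 by rewrite -size_poly_gt0 (leq_ltn_trans _ size_pq).
apply: (@vge_integral f); rewrite ?lc_f ?fmorph_eq0 ?lead_coef_eq0 //.
- move=> i; rewrite coefB coefZ !coef_map.
  by rewrite vgeB ?vge_cst // vgeM0 ?vge_cst ?vge_emb.
- by rewrite valuation_cst // lead_coef_eq0.
by rewrite /root !hornerE y_root subrr.
Qed.

Let GE : (map_poly cst G).[y] = pi * (map_poly cst q).[y].
Proof.
rewrite rmorphB /= map_polyZ !hornerE y_root rmorphB /= mulrBl.
by [].
Qed.

(** The start of Hensel's lemma: G(y) = (x - al) q(y) has positive value, so y reduces to some root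
    eta of G. *)
Lemma root_residue : exists2 eta, root G eta & vge (y - cst eta) e.
Proof.
have y0 := root_integral.
have G0 : G != 0.
  rewrite -size_poly_gt0 size_polyDl; first exact: leq_ltn_trans size_pq.
  by rewrite size_polyN (leq_ltn_trans (size_scale_leq _ _)).
have Gy : vge (map_poly cst G).[y] e.
  by rewrite GE mulrC vgeM0 // vge_horner.
have [eta r_eta y_eta] : exists2 eta, root G eta & vge (y - cst eta) 1.
  have [rs def_G] := closed_field_poly_normal G.
  have {Gy} : vge (map_poly cst G).[y] 1 by apply: vge_le Gy; lia.
  have rs_G s : s \in rs -> root G s.
    by move=> s_rs; rewrite def_G rootZ ?lead_coef_eq0 // root_prod_XsubC.
  rewrite {1}def_G map_polyZ hornerZ => Gy.
  have {Gy} : vge (map_poly cst (\prod_(z <- rs) ('X - z%:P))).[y] 1.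
    have lc0 : cst (lead_coef G) != 0 by rewrite fmorph_eq0 lead_coef_eq0.
    by rewrite -[X in vge X](mulKf lc0) -fmorphV vgeM0 // vge_cst.
  elim: rs rs_G {def_G} => [|s rs IHrs] rs_G.
    by rewrite big_nil rmorph1 hornerC /vge oner_eq0 valuation1.
  rewrite big_cons rmorphM /= map_polyXsubC hornerM hornerXsubC => Gy.
  have [y_s | y_s] := boolP (vge (y - cst s) 1).
    by exists s; rewrite ?rs_G ?mem_head.
  apply: IHrs => [t t_rs|]; first by rewrite rs_G // inE t_rs orbT.
  have : vge (y - cst s) 0 by rewrite vgeB ?vge_cst.
  move: y_s Gy; rewrite /vge negb_or => /andP[ys0 ys1].
  rewrite (negPf ys0) mulf_eq0 (negPf ys0) /=.
  have [//|pr0 /=] := eqVneq (map_poly cst (\prod_(z <- rs) ('X - z%:P))).[y] 0.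
  rewrite wM // -ltNge in ys1 * => le1 _.
  by rewrite -(lerD2l (w (y - cst s))) (le_trans _ le1) // gerDr; lia.
(* Since eta is a simple root, the cofactor H is a unit at y, and y - eta inherits the full value e
   of G(y). *)
exists eta => //; have /factor_theorem[H def_H] := r_eta.
have Heta : ~~ root H eta.
  have := simple_pq r_eta; rewrite def_H derivM derivXsubC mulr1.
  by rewrite /root !hornerE subrr mulr0 add0r.
have [Hy0 wHy] : (map_poly cst H).[y] != 0 /\ w (map_poly cst H).[y] = 0.
  have rH : root (H - H.[eta]%:P) eta by rewrite /root !hornerE subrr.
  have -> : (map_poly cst H).[y]
      = cst H.[eta] + (map_poly cst (H - H.[eta]%:P)).[y].
    by rewrite rmorphB /= map_polyC hornerD hornerN hornerC addrC subrK.
  have c0 : cst H.[eta] != 0 by rewrite fmorph_eq0.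
  have wc0 : w (cst H.[eta]) = 0 by rewrite valuation_cst.
  have := vge_horner_root y_eta y0 rH.
  by move=> /(valuation_dominant c0); rewrite wc0 => /(_ isT).
have : vge ((y - cst eta) * (map_poly cst H).[y]) e.
  by rewrite mulrC -hornerXsubC -map_polyXsubC -hornerM -rmorphM -def_H.
rewrite /vge mulf_eq0 (negPf Hy0) orbF.
by have [// | y_eta0 /=] := eqVneq (y - cst eta) 0; rewrite wM // wHy addr0.
Qed.

(* Newton's iteration, with the derivative frozen at its residue kappa. *)
Lemma root_approx (N : nat) : exists A, vge (y - emb A) (N%:Z * e).
Proof.
have [eta r_eta y_eta] := root_residue; have y0 := root_integral.
case: N => [|N]; first by exists 0; rewrite rmorph0 subr0 mul0r.
(* The iteration starts at precision e: the quadratic error has precision 2 (N + 1) e, which is at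
   least (N + 2) e. *)
elim: N => [|N [A yA]]; first by exists eta%:P; rewrite mul1r.
pose kappa := G^`().[eta]; have k0 : kappa != 0 by apply: simple_pq.
pose Psi := p \Po A - 'X * (q \Po A).
exists (A - kappa^-1 *: Psi).
have embE (f : {poly algC}) : emb (f \Po A) = (map_poly cst f).[emb A].
  rewrite embX_horner map_comp_poly horner_comp; congr _.[_].
  by rewrite -embX_horner.
have [r r0 tp] := taylor2 p y0 (vge_emb A).
have [r' r'0 tq] := taylor2 q y0 (vge_emb A).
have PsiE : emb Psi
    = (emb A - y) * ((map_poly cst G^`()).[y] - pi * (map_poly cst q^`()).[y])
      + (emb A - y) ^+ 2 * (r - emb 'X * r').
  apply: (@etrans _ _ (((map_poly cst p).[emb A] - (map_poly cst p).[y])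
     - emb 'X * ((map_poly cst q).[emb A] - (map_poly cst q).[y]))).
    by rewrite rmorphB rmorphM /= !embE y_root; ring.
  rewrite tp tq derivB derivZ !rmorphB /= map_polyZ !hornerE -/(cst al).
  by ring.
have kk : cst kappa * cst kappa^-1 = 1 by rewrite -rmorphM mulfV // rmorph1.
(* In the linear term the factor has value at least e, because kappa = G'(eta) and y is congruent to
   eta; each step thus gains one e. *)
have -> : y - emb (A - kappa^-1 *: Psi) =
    (emb A - y) * (cst kappa^-1
      * ((map_poly cst G^`()).[y] - cst kappa - pi * (map_poly cst q^`()).[y]))
    + (emb A - y) ^+ 2 * (cst kappa^-1 * (r - emb 'X * r')).
  rewrite rmorphB -mul_polyC rmorphM /= -/(cst _) PsiE.
  have := kk; move: (cst kappa) (cst kappa^-1) => c c' cc'.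
  rewrite -[RHS]addr0 -[0](mulr0 (emb A - y)).
  rewrite -[X in _ = _ + _ * X](subrr 1) -{1}cc'.
  by ring.
have yA' : vge (emb A - y) (N.+1%:Z * e) by rewrite -vgeN opprB.
have e_pos : 0 <= e by apply: ltW.
apply: vgeD.
  have -> : N.+2%:Z * e = N.+1%:Z * e + e.
    by rewrite -[N.+2]addn1 PoszD mulrDl mul1r.
  apply: vgeM => //; apply: vgeM0; first exact: vge_cst.
  apply: vgeB; last by rewrite mulrC vgeM0 ?vge_horner.
  have rG : root (G^`() - kappa%:P) eta by rewrite /root !hornerE subrr.
  have := vge_horner_root y_eta y0 rG.
  by rewrite rmorphB /= map_polyC hornerD hornerN hornerC.
apply: (@vge_le _ (N.+1%:Z * e + N.+1%:Z * e + 0)).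
  by rewrite addr0 -mulrDl ler_wpM2r // -PoszD lez_nat addSn ltnS leq_addl.
rewrite expr2 !vgeM // vgeM0 ?vge_cst // vgeB //.
by rewrite vgeM0 // vge_emb.
Qed.

End Root.

End Valuation.

(* Qbar(x) is dense in L for w, hence w takes the value 1 on Qbar(x), where all
   values are multiples of w (x - al). *)
Lemma unramified_adjoin (L : fieldExtType Qbarx) (rs : seq L) (al : algC) :
  <<1 & rs>>%VS = {:L}%VS ->
  (forall r, r \in rs -> exists p q : {poly algC},
    [/\ (size q < size p)%N,
        forall s, root (p - al *: q) s -> ~~ root (p - al *: q)^`() s
      & (map_poly (embC L) p).[r] = embX L 'X * (map_poly (embC L) q).[r]]) ->
  unramified_at L al.
Proof.
move=> gen_rs rs_root w dv w_al.
pose dense g := forall N : nat, exists k : Qbarx, vge w (g - k%:A) N%:Z.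
have dense_all g : dense g.
  apply: (adjoin_seq_ind (P := dense) (rs := rs)); last by rewrite gen_rs memvf.
  - by move=> k N; exists k; rewrite subrr vge0.
  - move=> {}g h g_d h_d N; have [k gk] := g_d N; have [l hl] := h_d N.
    by exists (k + l); rewrite scalerDl opprD addrACA; apply: vgeD.
  - move=> {}g h g_d h_d N.
    (* The precision for h makes up for the pole of g; then l is fixed, and the precision for g
       makes up for the pole of l. *)
    have [M gM] := vge_exists w g; have [l hl] := h_d (N + M)%N.
    have [M' lM] := vge_exists w l%:A; have [k gk] := g_d (N + M')%N.
    exists (k * l); rewrite (_ : _ - _ = g * (h - l%:A) + (g - k%:A) * l%:A).
      apply: vgeD => //.
        apply: vge_le (vgeM dv gM hl); rewrite PoszD; lia.
      apply: vge_le (vgeM dv gk lM); rewrite PoszD; lia.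
    by rewrite mulrBr mulrBl -addrA; congr (_ + _); rewrite addKr -scalerA mulr_algl.
  move=> r /rs_root[p [q [spq simple r_root]]] N.
  have [A rA] := root_approx dv w_al spq simple r_root N.
  exists (FracField.tofrac A); apply: vge_le rA.
  by rewrite ler_peMr //; lia.
have [g g0 wg] := valuation_onto dv; have [k gk] := dense_all g 2.
have [k0 wk] : (k%:A : L) != 0 /\ w k%:A = 1.
  have <- : g + - (g - k%:A) = k%:A :> L by rewrite opprB addrC subrK.
  by rewrite -wg; apply: (valuation_dominant dv g0 (N := 2)); rewrite ?wg ?vgeN.
have [|m] := @valuation_scalar _ _ dv _ w_al k. 
  by apply: contraNneq k0 => ->; rewrite scale0r.
rewrite wk => wm; move: w_al wm; move: (w _) => e e0 wm.
have := dvdz_mull m (dvdzz e); rewrite -wm dvdz1 => /eqP; lia.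
Qed.

(** * Kummer theory *)

Lemma embC_mem (L : fieldExtType Qbarx) (M : {subfield L}) c : embC L c \in M.
Proof. by rewrite rpredZ ?rpred1. Qed.

Lemma char0_natr_neq0 (L : fieldExtType Qbarx) n : (0 < n)%N -> n%:R != 0 :> L.
Proof.
move=> n0; rewrite -[n%:R](rmorph_nat (embC L)) fmorph_eq0 pnatr_eq0.
by rewrite -lt0n.
Qed.

Lemma algC_unity_root (L : fieldExtType Qbarx) n (v : L) : (0 < n)%N ->
  v ^+ n = 1 -> exists c, v = embC L c.
Proof.
move=> n0 vn; have [rs] := closed_field_poly_normal ('X^n - 1 : {poly algC}).
rewrite (monicP (monicXnsubC 1 n0)) scale1r => def_rs.
have : root (map_poly (embC L) ('X^n - 1)) v.
  by rewrite rmorphB rmorph1 /= map_polyXn /root !hornerE vn subrr.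
rewrite def_rs rmorph_prod /root horner_prod prodf_seq_eq0 => /hasP[c _ /=].
by rewrite map_polyXsubC hornerXsubC subr_eq0 => /eqP ->; exists c.
Qed.

Lemma galTraceZ (F : fieldType) (L : splittingFieldType F)
    (M E : {subfield L}) a u :
  a \in M -> (M <= E)%VS -> galTrace M E (a * u) = a * galTrace M E u.
Proof.
move=> Ma sME; rewrite /galTrace mulr_sumr; apply: eq_bigr => g Gg.
by rewrite rmorphM /= (fixed_gal sME Gg Ma).
Qed.

(** Some g moves u, and g(u) = c u for a root of unity c != 1, which is a constant. Invariance of
    the trace gives Tr u = c Tr u. *)
Lemma kummer_trace (L : splittingFieldType Qbarx) (M : {subfield L}) (n : nat)
    (u : L) :
  galois M {:L} -> (0 < n)%N -> u ^+ n \in M -> u \notin M ->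
  galTrace M {:L} u = 0.
Proof.
move=> galM n0 un uM; have sM := subvf M.
have [u0 | u0] := eqVneq u 0; first by rewrite u0 rpred0 in uM.
have [g Gg gu] : exists2 g, g \in 'Gal({:L} / M)%g & g u != u.
  apply: NNPP => no_g; case/negP: uM; rewrite -(galois_fixedField galM).
  apply/fixedFieldP; first exact: memvf.
  by move=> g Gg; apply/eqP/negPn/negP => gu; apply: no_g; exists g.
have [c def_c] : exists c, g u / u = embC L c.
  apply: (algC_unity_root n0).
  by rewrite expr_div_n -rmorphXn /= (fixed_gal sM Gg un) divff ?expf_neq0.
have {def_c} def_c : g u = embC L c * u by rewrite -def_c divfK.
have := galTrace_gal (memvf u) Gg; rewrite def_c galTraceZ ?embC_mem //.
move/eqP; rewrite -subr_eq0 -{2}[galTrace _ _ _]mul1r -mulrBl mulf_eq0.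
case/orP => /eqP // /(canRL (subrK 1)); rewrite add0r => c1.
by rewrite def_c c1 mul1r eqxx in gu.
Qed.

(* The trace of y ^+ i / z vanishes unless this quotient lies in M, while 1 is an
   M-linear combination of these quotients and has nonzero trace. *)
Lemma kummer_step (L : splittingFieldType Qbarx) (M : {subfield L}) (n : nat)
    (y z : L) :
  galois M {:L} -> (0 < n)%N -> y ^+ n \in M -> z ^+ n \in M ->
  z \in <<M; y>>%VS -> exists i, exists2 m, m \in M & z = m * y ^+ i.
Proof.
move=> galM n0 yn zn z_in; have sM := subvf M.
have [-> | z0] := eqVneq z 0.
  by exists 0%N, 0; rewrite ?rpred0 // mul0r.
have [[i ui] | no_u] := classic (exists i, y ^+ i / z \in M).
  have [yi0 | yi0] := eqVneq (y ^+ i) 0.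
    have y0 : y = 0 by apply/eqP; move/eqP: yi0; rewrite expf_eq0 => /andP[].
    exists 0%N, z; last by rewrite mulr1.
    move: z_in; rewrite y0 => /Fadjoin_polyP[p pM ->].
    by rewrite rpred_horner ?rpred0.
  exists i, (y ^+ i / z)^-1; first by rewrite rpredV.
  by rewrite invf_div divfK.
have : galTrace M {:L} (z / z) = 0.
  case/Fadjoin_polyP: z_in => p pM def_z; rewrite {1}def_z horner_coef mulr_suml.
  rewrite raddf_sum big1 // => i _ /=; rewrite -mulrA galTraceZ ?(polyOverP pM) //.
  rewrite (kummer_trace galM n0) ?mulr0 //; last first.
    by apply/negP => ui; apply: no_u; exists i.
  by rewrite expr_div_n exprAC rpred_div // rpredX.
rewrite divff // /galTrace.
under eq_bigr do rewrite rmorph1.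
by rewrite sumr_const => /eqP; rewrite (negPf (char0_natr_neq0 _ _)).
Qed.

(** Generators are removed one at a time. If z = m y^i with m in the field without y, then m^n = z^n
    / (y^i)^n is again in E, so the induction applies to m. Repetitions in [ts] encode the
    exponents. *)
Lemma kummer_radicals (L : splittingFieldType Qbarx) (E : {subfield L}) (n : nat)
    (ys : seq L) (z : L) :
  galois E {:L} -> (0 < n)%N ->
  {in ys, forall y, y ^+ n \in E} -> z ^+ n \in E -> z \in <<E & ys>>%VS ->
  exists ts : seq L, {subset ts <= ys} /\
    exists2 m, m \in E & z = m * \prod_(t <- ts) t.
Proof.
move=> galE n0; elim/last_ind: ys z => [|ys y IHys] z ysn zn.
  rewrite adjoin_nil subfield_closed => Ez; exists [::]; split=> //.
  by exists z; rewrite // big_nil mulr1.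
rewrite adjoin_rcons => z_in.
have sEM : (E <= <<E & ys>>)%VS by apply: subv_adjoin_seq.
have galM : galois <<E & ys>> {:L}.
  by apply: galoisS galE; rewrite sEM subvf.
have [||i [m Mm def_z]] := kummer_step galM n0 _ _ z_in.
- by apply: (subvP sEM); rewrite ysn // mem_rcons mem_head.
- exact: (subvP sEM).
have [y0 | y0] := eqVneq (y ^+ i) 0.
  exists [::]; split=> //; exists 0; first exact: rpred0.
  by rewrite def_z y0 mulr0 mul0r.
have ys_n : {in ys, forall t, t ^+ n \in E}.
  by move=> t t_ys; rewrite ysn // mem_rcons inE t_ys orbT.
have yn : y ^+ n \in E by rewrite ysn // mem_rcons mem_head.
have [|ts [ts_ys [m' Em' def_m]]] := IHys m ys_n _ Mm.
  rewrite (_ : m = z / y ^+ i); last by rewrite def_z mulfK.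
  by rewrite expr_div_n exprAC rpred_div // rpredX.
exists (ts ++ nseq i y); split=> [t|].
  rewrite mem_cat mem_rcons inE => /orP[/ts_ys -> | ]; first by rewrite orbT.
  by rewrite mem_nseq => /andP[_ ->].
exists m' => //; rewrite def_z def_m big_cat /= big_nseq mulrA.
by rewrite -Monoid.iteropE.
Qed.

(** * Norms and orders *)

Lemma pchar_Qbarx (L : fieldExtType Qbarx) : [pchar L] =i pred0.
Proof.
by apply/pcharf0P => n; rewrite -(rmorph_nat (embC L)) fmorph_eq0 pnatr_eq0.
Qed.

Lemma splitting_galois (L : splittingFieldType Qbarx) (E : {subfield L})
    (f : {poly L}) :
  f \is a polyOver 1%VS -> splittingFieldFor 1 f E -> galois 1 E.
Proof.
move=> f1 splE; apply/and3P; split; first exact: sub1v.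
  by apply/separableP => x _; apply/pcharf0_separable/pchar_Qbarx.
by apply/splitting_normalField; [apply: sub1v | exists f].
Qed.

(** Each root has degree at most d over the preceding field. This crude bound is what p has to
    exceed. *)
Lemma dim_adjoin_roots (F : fieldType) (L : fieldExtType F) (f : {poly L})
    (ss : seq L) (d : nat) :
  f \is a polyOver 1%VS -> f != 0 -> (size f <= d.+1)%N -> all (root f) ss ->
  (\dim <<1 & ss>> <= d ^ size ss)%N.
Proof.
move=> f1 f0 size_f; elim/last_ind: ss => [|ss s IHss] /=.
  by rewrite adjoin_nil subfield_closed dimv1.
rewrite all_rcons => /andP[fs fss].
rewrite adjoin_rcons dim_Fadjoin size_rcons expnS leq_mul ?IHss //.
rewrite -ltnS -size_minPoly (leq_trans _ size_f) // dvdp_leq //.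
by apply: minPoly_dvdp => //; apply: polyOverSv f1; apply: sub1v.
Qed.

Lemma mupX (F : fieldType) (r : F) (A : {poly F}) n : A != 0 ->
  mup r (A ^+ n) = (mup r A * n)%N.
Proof.
move=> A0; elim: n => [|n IHn]; first by rewrite expr0 muln0 mupNroot ?root1.
by rewrite exprS mupM ?expf_neq0 // IHn mulnS.
Qed.

(** * Orders of rational functions in a nonconstant element *)

Section Transcendental.

Variables (L : fieldExtType Qbarx) (v : L).
Hypothesis v_tr : forall c, v != embC L c.

(** Qbar is algebraically closed, so A(v) is a nonzero constant times factors v - c. *)
Lemma transcendental_horner (A : {poly algC}) :
  A != 0 -> (map_poly (embC L) A).[v] != 0.
Proof.
move=> A0; have [rs ->] := closed_field_poly_normal A.
rewrite map_polyZ hornerZ mulf_neq0 ?fmorph_eq0 ?lead_coef_eq0 //.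
rewrite rmorph_prod horner_prod prodf_seq_neq0; apply/allP => c _ /=.
by rewrite map_polyXsubC hornerXsubC subr_eq0 v_tr.
Qed.

Definition eval_at (A : {poly algC}) : L := (map_poly (embC L) A).[v].
HB.instance Definition _ := GRing.RMorphism.copy eval_at
  (horner_eval v \o map_poly (embC L)).

Lemma eval_at_neq0 A : A != 0 -> eval_at A != 0.
Proof. exact: transcendental_horner. Qed.

Lemma eval_at_inj A B : eval_at A = eval_at B -> A = B.
Proof.
move=> eAB; apply/eqP; rewrite -subr_eq0; apply/negPn/negP => /eval_at_neq0.
by rewrite rmorphB /= eAB subrr eqxx.
Qed.

Definition fraction_of (z : L) (AB : {poly algC} * {poly algC}) :=
  [/\ AB.1 != 0, AB.2 != 0 & z * eval_at AB.2 = eval_at AB.1].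

(* The order at v = r of an element of Qbar(v), and junk elsewhere. *)
Definition ord_at (r : algC) (z : L) : int :=
  let AB := epsilon (inhabits (0, 0)) (fraction_of z) in
  (mup r AB.1)%:Z - (mup r AB.2)%:Z.

Lemma ord_atE r z A B : A != 0 -> B != 0 -> z * eval_at B = eval_at A ->
  ord_at r z = (mup r A)%:Z - (mup r B)%:Z.
Proof.
move=> A0 B0 zE; rewrite /ord_at.
have : exists AB, fraction_of z AB by exists (A, B).
move/(epsilon_spec (inhabits (0, 0))); set AB := epsilon _ _.
case: AB => A' B' [/= A'0 B'0 zE'].
have e : A * B' = A' * B.
  apply: eval_at_inj; rewrite !rmorphM /= -zE -zE'; ring.
have := mupM r A0 B'0; rewrite e mupM //; lia.
Qed.

Definition rational z := z = 0 \/ exists AB, fraction_of z AB.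

Lemma ord_atM r z y : rational z -> rational y -> z != 0 -> y != 0 ->
  ord_at r (z * y) = ord_at r z + ord_at r y.
Proof.
case=> [-> _ /eqP // | [[A B] [/= A0 B0 zE]]].
case=> [-> _ /eqP // | [[C D] [/= C0 D0 yE]]] _ _.
rewrite (ord_atE r A0 B0 zE) (ord_atE r C0 D0 yE).
rewrite (@ord_atE r _ (A * C) (B * D)) ?mulf_neq0 //.
  by rewrite !mupM //; lia.
by rewrite !rmorphM /= -zE -yE; ring.
Qed.

Lemma ord_atX r z n : rational z -> z != 0 -> ord_at r (z ^+ n) = ord_at r z *+ n.
Proof.
case=> [-> /eqP // | [[A B] [/= A0 B0 zE]]] _.
rewrite (ord_atE r A0 B0 zE) (@ord_atE r _ (A ^+ n) (B ^+ n)) ?expf_neq0 //.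
  by rewrite !mupX // -mulr_natr; lia.
by rewrite !rmorphXn /= -zE exprMn.
Qed.

Lemma ord_at_eval r A : A != 0 -> ord_at r (eval_at A) = mup r A.
Proof.
move=> A0; rewrite (@ord_atE r _ A 1) ?oner_neq0 ?rmorph1 ?mulr1 //.
by rewrite (mupNroot (root1 _)) subr0.
Qed.

Lemma ord_at_integral r z : rational z -> z != 0 -> integralOver eval_at z ->
  0 <= ord_at r z.
Proof.
case=> [-> /eqP // | [[A B] [/= A0 B0 zE]]] z0 [p mon_p pz].
rewrite (ord_atE r A0 B0 zE) subr_ge0 lez_nat leqNgt; apply/negP => lt_AB.
have [n size_p] : exists n, size p = n.+1.
  by exists (size p).-1; rewrite prednK // size_poly_gt0 monic_neq0.
have pn : p`_n = 1 by rewrite -(monicP mon_p) lead_coefE size_p.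
(* The integral equation of A / B with denominators cleared. If B vanishes at r to higher order than
   A, every term on the right vanishes to higher order than A^n. *)
have key : A ^+ n = - \sum_(i < n) p`_i * (A ^+ i * B ^+ (n - i)).
  apply/eqP; rewrite -addr_eq0 addrC; apply/eqP/eval_at_inj.
  rewrite rmorph0 -[RHS](mulr0 (eval_at B ^+ n)) -(eqP pz).
  rewrite (horner_coef_wide z (n := n.+1)).
    rewrite rmorphD rmorph_sum mulr_sumr big_ord_recr /= coef_map /= pn.
    rewrite rmorph1 mul1r.
    congr (_ + _); last by rewrite rmorphXn /= -zE exprMn mulrC.
    apply: eq_bigr => i _; rewrite coef_map /= !rmorphM !rmorphXn /= -zE exprMn.
    have -> : eval_at B ^+ n = eval_at B ^+ i * eval_at B ^+ (n - i).
      by rewrite -exprD subnKC // ltnW.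
    by ring.
  by rewrite -size_p size_poly.
have An0 : A ^+ n != 0 by rewrite expf_neq0.
have : ((mup r A * n).+1 <= mup r (A ^+ n))%N.
  rewrite mup_geq // key dvdpNr.
  apply: (big_ind (fun C => ('X - r%:P) ^+ (mup r A * n).+1 %| C)) => [|x y|i _].
  - exact: dvdp0.
  - exact: dvdp_add.
  apply: dvdp_mull; rewrite -mup_geq ?mulf_neq0 ?expf_neq0 // mupM ?expf_neq0 //.
  rewrite !mupX //; have := ltn_ord i; nia.
by rewrite mupX // ltnn.
Qed.

End Transcendental.

(** * The coordinate sigma = 1/s at s = oo *)

Section Norm.

Variables (L : splittingFieldType Qbarx) (P Q : {poly algC}) (n : nat).
Hypothesis size_Q : size Q = n.+1.
Hypothesis size_P : size P = n.+2.
Hypothesis coprime_PQ : forall c, root P c -> ~~ root Q c.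

Local Notation cst := (embC L).
Local Notation x := (embX L 'X).
Local Notation f := (map_poly cst P - x *: map_poly cst Q).

Let Q_neq0 : Q != 0. Proof. by rewrite -size_poly_eq0 size_Q. Qed.
Let P_neq0 : P != 0. Proof. by rewrite -size_poly_eq0 size_P. Qed.

Lemma covering_lead_coef : lead_coef f = cst (lead_coef P).
Proof.
rewrite lead_coefDl ?lead_coef_map // size_polyN.
rewrite (leq_ltn_trans (size_scale_leq _ _)) // !size_map_poly size_Q size_P //.
Qed.

Lemma covering_over1 : f \is a polyOver 1%VS.
Proof.
rewrite rpredB //; first by apply/polyOverP => i; rewrite coef_map embC_mem.
apply/polyOverP => i; rewrite coefZ coef_map rpredM ?embC_mem //.
by rewrite rpredZ ?rpred1.
Qed.

(** A constant root c would give P(c) = x Q(c), hence a common root of P and Q. *)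
Lemma covering_root_transcendental s c : root f s -> s != cst c.
Proof.
move=> fs; apply: contraTneq fs => ->; rewrite /root !hornerE !horner_map /=.
apply/negP; rewrite -/(embC L _) -/(embC L _) => e.
have : embX L (P.[c]%:P - 'X * Q.[c]%:P) == 0 by rewrite rmorphB rmorphM.
rewrite embX_eq0 => /eqP e0; have := congr1 (fun A : {poly algC} => A`_0) e0.
have := congr1 (fun A : {poly algC} => A`_1) e0.
rewrite !coefB !coefXM !coefC /= sub0r subr0 => /eqP; rewrite oppr_eq0 => Qc Pc.
by have := coprime_PQ (introT eqP Pc); rewrite /root Qc.
Qed.

Section Place.

Variable s : L.
Hypothesis fs : root f s.

Local Notation sigma := s^-1.
Local Notation F := <<1; s>>%AS.

Let s_tr c : s != cst c. Proof. exact: covering_root_transcendental. Qed.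

Let s_neq0 : s != 0. Proof. by rewrite -(rmorph0 cst) s_tr. Qed.

Lemma sigma_transcendental c : sigma != cst c.
Proof. by apply: contraNneq (s_tr c^-1) => e; rewrite fmorphV /= -e invrK. Qed.
Local Notation sigma_tr := sigma_transcendental.

Local Notation ev := (eval_at sigma).
Local Notation Qh := (rev_poly n Q).
Local Notation Ph := (rev_poly n.+1 P).

Lemma ev_rev_poly m (A : {poly algC}) : (size A <= m.+1)%N ->
  ev (rev_poly m A) = sigma ^+ m * (map_poly cst A).[s].
Proof.
move=> size_A; rewrite /eval_at map_rev_poly horner_rev_poly ?invr_eq0 ?invrK //.
by rewrite size_map_poly.
Qed.

Lemma ev_X : ev 'X = sigma. Proof. by rewrite /eval_at map_polyX hornerX. Qed.
Lemma ev_C c : ev c%:P = cst c. Proof. by rewrite /eval_at map_polyC hornerC. Qed.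

(** The equation x = P(s)/Q(s) in the coordinate sigma. Neither [Qh] nor [Ph] vanishes at 0, so x
    has a simple pole at sigma = 0. *)
Lemma covering_at : sigma * x * ev Qh = ev Ph.
Proof.
have /eqP := fs; rewrite hornerD hornerN hornerZ => /subr0_eq fs0.
by rewrite !ev_rev_poly ?size_Q ?size_P // exprS fs0; ring.
Qed.

Let Qh0 : ~~ root Qh 0.
Proof.
rewrite /root horner_coef0 coef_rev_poly // subn0.
by have := Q_neq0; rewrite -lead_coef_eq0 lead_coefE size_Q.
Qed.

Let nonroot_neq0 (A : {poly algC}) c : ~~ root A c -> A != 0.
Proof. by apply: contraNneq => ->; rewrite root0. Qed.

Let Qh_neq0 := nonroot_neq0 Qh0.
Let rationalI A B (z : L) : B != 0 -> z * ev B = ev A -> rational sigma z.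
Proof.
move=> B0 zE; have [z0 | z0] := eqVneq z 0; [by left | right; exists (A, B)].
split=> //=; apply: contra_neq z0 => A0; move/eqP: zE.
by rewrite A0 rmorph0 mulf_eq0 (negPf (eval_at_neq0 sigma_tr B0)) orbF => /eqP.
Qed.

Let rationalE z : rational sigma z -> exists A B, B != 0 /\ z * ev B = ev A.
Proof.
case=> [-> | [[A B] [_ B0 zE]]]; last by exists A, B.
by exists 0, 1; rewrite oner_neq0 rmorph0 mul0r.
Qed.

Lemma rationalD z y :
  rational sigma z -> rational sigma y -> rational sigma (z + y).
Proof.
move=> /rationalE[A [B [B0 zE]]] /rationalE[C [D [D0 yE]]].
apply: (@rationalI (A * D + C * B) (B * D)); first by rewrite mulf_neq0.
by rewrite rmorphD !rmorphM /= -zE -yE; ring.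
Qed.

Lemma rationalM z y :
  rational sigma z -> rational sigma y -> rational sigma (z * y).
Proof.
move=> /rationalE[A [B [B0 zE]]] /rationalE[C [D [D0 yE]]].
apply: (@rationalI (A * C) (B * D)); first by rewrite mulf_neq0.
by rewrite !rmorphM /= -zE -yE; ring.
Qed.

Lemma rationalV z : rational sigma z -> rational sigma z^-1.
Proof.
case=> [-> | [[A B] [A0 B0 zE]]]; first by left; rewrite invr0.
apply: (@rationalI B A) => //; rewrite -zE /=.
have z0 : z != 0.
  apply: contra_neq A0 => z0; move/eqP: zE; rewrite z0 mul0r eq_sym /= => e.
  by apply/eqP; apply: contraTT e => /(eval_at_neq0 sigma_tr).
by rewrite mulKf.
Qed.

Lemma rational_ev A : rational sigma (ev A).
Proof. by apply: (@rationalI A 1); rewrite ?oner_neq0 // rmorph1 mulr1. Qed.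

(** By [covering_at], x itself is a rational function of sigma, so Qbar(x, s) is Qbar(sigma). *)
Lemma rational_F z : z \in F -> rational sigma z.
Proof.
have r_x : rational sigma x.
  apply: (@rationalI Ph ('X * Qh)); first by rewrite mulf_neq0 ?polyX_eq0.
  by rewrite rmorphM /= ev_X mulrCA mulrA covering_at.
have r_emb (A : {poly algC}) : rational sigma (embX L A).
  rewrite embX_horner; elim/poly_ind: A => [|A c IHA].
    by left; rewrite rmorph0 horner0.
  rewrite rmorphD rmorphM /= map_polyX map_polyC hornerD hornerM hornerX hornerC.
  by apply: rationalD; [apply: rationalM | have := rational_ev c%:P; rewrite ev_C].
rewrite /= -adjoin_seq1; apply: adjoin_seq_ind => [k | | |r].
- have -> : k%:A = embX L \n_(repr k) / embX L \d_(repr k).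
    by rewrite {1}(fracE k) -in_algE rmorphM fmorphV.
  by apply: rationalM; last apply: rationalV; apply: r_emb.
- exact: rationalD.
- exact: rationalM.
by rewrite inE => /eqP ->; have := rationalV (rational_ev 'X); rewrite ev_X invrK.
Qed.

Section Integral.

Variable g : {poly L}.
Hypothesis def_f : f = g * ('X - s%:P).

(* Reading the division of f by 'X - s from the constant term upwards, the
   coefficients of g satisfy g_k = sigma (g_(k-1) - f_k), and sigma x is integral
   at sigma = 0, up to the unit ev Qh; the leading coefficient of g is constant. *)
Lemma integral_quotient_root t : root g t -> integralOver ev (ev Qh * t).
Proof.
set c := ev Qh => gt.
have c0 : c != 0 by apply: eval_at_neq0 Qh_neq0; apply: sigma_tr.
have mon_X : 'X - s%:P \is monic by apply: monicXsubC.
have lead_g : lead_coef g = cst (lead_coef P).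
  by rewrite -covering_lead_coef def_f lead_coef_Mmonic.
have lc0 : lead_coef g != 0 by rewrite lead_g fmorph_eq0 lead_coef_eq0.
have size_f : size f = n.+2.
  rewrite size_polyDl size_map_poly // size_polyN.
  by rewrite (leq_ltn_trans (size_scale_leq _ _)) // !size_map_poly size_Q size_P.
have size_g : size g = n.+1.
  apply/eqP; rewrite -eqSS -size_f def_f size_Mmonic // -?size_poly_eq0.
    by rewrite size_XsubC addn2.
  by apply: contraNneq lc0 => g0; rewrite lead_coef_eq0 -size_poly_eq0 g0.
have coef_f k : exists A, sigma * c * f`_k = ev A.
  exists ('X * Qh * (P`_k)%:P - Ph * (Q`_k)%:P).
  rewrite rmorphB !rmorphM /= ev_X !ev_C coefB coefZ !coef_map -covering_at.
  by rewrite /=; ring.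
have coef_g k : exists A, c * g`_k = ev A.
  have gE i : g`_i = sigma * (if i is j.+1 then g`_j else 0) - sigma * f`_i.
    rewrite def_f mulrBr coefB coefMX coefMC; case: i => [|i] /=.
      by rewrite sub0r mulr0 sub0r mulrN opprK mulrCA mulVf ?mulr1.
    by rewrite mulrBr opprB addrC subrK mulrCA mulVf ?mulr1.
  elim: k => [|k [A cA]].
    have [B cB] := coef_f 0%N; exists (- B); rewrite gE mulr0 sub0r rmorphN /= -cB.
    by ring.
  have [B cB] := coef_f k.+1; exists ('X * A - B).
  by rewrite gE rmorphB rmorphM /= ev_X -cA -cB; ring.
(* The monic polynomial c^n g(T/c) / lead_coef P, which has the root c t. For k < n at least one
   factor c is available to turn g_k into a polynomial in sigma. *)
pose h := \poly_(k < n.+1) (cst (lead_coef P)^-1 * g`_k * c ^+ (n - k)).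
have lcK : cst (lead_coef P)^-1 * lead_coef g = 1.
  by rewrite lead_g -rmorphM mulVf ?rmorph1 // lead_coef_eq0.
have hn : cst (lead_coef P)^-1 * g`_n * c ^+ (n - n) = 1.
  by rewrite subnn mulr1 -[RHS]lcK [lead_coef g]lead_coefE size_g.
apply: (@integral_root_monic _ _ _ _ h).
- by rewrite monicE lead_coef_poly //= hn ?oner_neq0.
- rewrite /root horner_poly.
  rewrite (eq_bigr (fun k : 'I_n.+1 =>
      cst (lead_coef P)^-1 * c ^+ n * (g`_k * t ^+ k))).
    by rewrite -mulr_sumr -size_g -horner_coef (eqP gt) mulr0.
  move=> k _; rewrite exprMn.
  have -> : c ^+ n = c ^+ (n - k) * c ^+ k by rewrite -exprD subnK // -ltnS.
  by ring.
have int_ev A : integralOver ev (ev A) by apply: integral_id.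
apply/integral_poly => k; rewrite coef_poly.
case: ltnP => [|_]; last exact: integral0.
rewrite ltnS leq_eqVlt => /orP[/eqP -> | lt_kn].
  by rewrite hn; apply: integral1.
have [A cA] := coef_g k; rewrite -(subnSK lt_kn) exprS.
rewrite (_ : _ * _ = cst (lead_coef P)^-1 * (c * g`_k) * c ^+ (n - k.+1));
  last by ring.
by rewrite cA -ev_C -rmorphXn -!rmorphM; apply: int_ev.
Qed.

End Integral.

End Place.

End Norm.

Lemma subfield_prod (F : fieldType) (L : fieldExtType F) (E : {subfield L})
    (ts : seq L) :
  {subset ts <= E} -> \prod_(t <- ts) t \in E.
Proof.
elim: ts => [|t ts IHts] sub; first by rewrite big_nil mem1v.
rewrite big_cons; apply: memvM; first by apply: sub; rewrite mem_head.
by apply: IHts => y y_ts; apply: sub; rewrite inE y_ts orbT.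
Qed.

Lemma prod_subC (R : comNzRingType) (ts : seq R) a :
  \prod_(t <- ts) (t - a) = (-1) ^+ size ts * \prod_(t <- ts) (a - t).
Proof.
elim: ts => [|t ts IHts]; first by rewrite !big_nil mulr1.
by rewrite !big_cons IHts /= exprS; ring.
Qed.

(** * Orders of norms from E to Qbar(s) *)

Section NormOrder.

Variables (L : splittingFieldType Qbarx) (P Q : {poly algC}) (n : nat).
Hypothesis size_Q : size Q = n.+1.
Hypothesis size_P : size P = n.+2.
Hypothesis coprime_PQ : forall c, root P c -> ~~ root Q c.

Local Notation cst := (embC L).
Local Notation x := (embX L 'X).
Local Notation f := (map_poly cst P - x *: map_poly cst Q).

Variable ss : seq L.
Hypothesis f_ss : f = cst (lead_coef P) *: \prod_(t <- ss) ('X - t%:P).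
Local Notation E := <<1 & ss>>%AS.

Let f_root t : t \in ss -> root f t.
Proof.
move=> t_ss; rewrite f_ss rootZ ?root_prod_XsubC //.
by rewrite fmorph_eq0 lead_coef_eq0 -size_poly_eq0 size_P.
Qed.

Variable s : L.
Hypothesis s_ss : s \in ss.
Local Notation sigma := s^-1.
Local Notation F := <<1; s>>%AS.
Local Notation ev := (eval_at sigma).
Local Notation Qh := (rev_poly n Q).
Local Notation m := #|'Gal(E / F)%g|.

Let fs := f_root s_ss.
Let s_tr := sigma_transcendental coprime_PQ fs.

Let sF : s \in F. Proof. exact: memv_adjoin. Qed.

Let sFE : (F <= E)%VS.
Proof.
apply/FadjoinP; split; first exact: sub1v.
exact: seqv_sub_adjoin.
Qed.

Lemma galois_place : galois F E.
Proof.
apply: (@galoisS _ _ 1%AS); first by rewrite sub1v.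
apply: (splitting_galois (covering_over1 L P Q)); exists ss => //.
rewrite f_ss; apply: eqp_scale.
by rewrite fmorph_eq0 lead_coef_eq0 -size_poly_eq0 size_P.
Qed.

Let galF := galois_place.

Lemma card_gal_place : (0 < m <= (n.+1) ^ size ss)%N.
Proof.
rewrite -(galois_dim galF) divn_gt0 ?adim_gt0 // dimvS //=.
apply: leq_trans (leq_div _ _) _; apply: (dim_adjoin_roots (f := f)).
- exact: covering_over1.
- rewrite -lead_coef_eq0 (covering_lead_coef _ size_Q size_P) fmorph_eq0.
  by rewrite lead_coef_eq0 -size_poly_eq0 size_P.
- rewrite (leq_trans (size_polyD _ _)) // size_polyN geq_max.
  rewrite size_map_poly size_P leqnn.
  by rewrite (leq_trans (size_scale_leq _ _)) // size_map_poly size_Q.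
by apply/allP => t; apply: f_root.
Qed.

(** Residue fields are Qbar, so this is the sum of the orders of z at all places of E above sigma =
    r. *)
Definition norm_ord r z := ord_at sigma r (galNorm F E z).

Let normF z : z \in E -> rational sigma (galNorm F E z).
Proof.
by move=> Ez; apply: (rational_F size_Q size_P coprime_PQ fs); apply: mem_galNorm.
Qed.

Lemma norm_ordM r z y : z \in E -> y \in E -> z != 0 -> y != 0 ->
  norm_ord r (z * y) = norm_ord r z + norm_ord r y.
Proof.
move=> Ez Ey z0 y0; rewrite /norm_ord galNormM.
by apply: (ord_atM s_tr); rewrite ?galNorm_eq0 //; apply: normF.
Qed.

Lemma norm_ordX r z k :
  z \in E -> z != 0 -> norm_ord r (z ^+ k) = norm_ord r z *+ k.
Proof.
move=> Ez z0; rewrite /norm_ord galNormX.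
by apply: (ord_atX s_tr); rewrite ?galNorm_eq0 //; apply: normF.
Qed.

Lemma norm_ord_prod r (ts : seq L) : {subset ts <= E} -> 0 \notin ts ->
  norm_ord r (\prod_(t <- ts) t) = \sum_(t <- ts) norm_ord r t.
Proof.
have ord1 : norm_ord r 1 = 0.
  rewrite /norm_ord galNorm1 -(rmorph1 ev) (ord_at_eval s_tr) ?oner_neq0 //.
  by rewrite mupNroot ?root1.
elim: ts => [|t ts IHts] sub ts0; first by rewrite !big_nil.
have [t0 {}ts0] : t != 0 /\ 0 \notin ts.
  by move: ts0; rewrite inE negb_or eq_sym => /andP.
have sub' : {subset ts <= E} by move=> y y_ts; apply: sub; rewrite inE y_ts orbT.
have Et : t \in E by apply: sub; rewrite mem_head.
rewrite !big_cons norm_ordM ?IHts //.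
  exact: subfield_prod.
by rewrite prodf_seq_neq0; apply/allP => y y_ts; apply: contraNneq ts0 => <-.
Qed.

Lemma norm_ordF r z : z \in F -> z != 0 -> norm_ord r z = ord_at sigma r z *+ m.
Proof.
move=> Fz z0; rewrite /norm_ord -(ord_atX s_tr) //; last first.
  exact: (rational_F size_Q size_P coprime_PQ fs).
congr ord_at; rewrite /galNorm (eq_bigr (fun=> z)) ?prodr_const // => g Gg.
exact: fixed_gal Gg Fz.
Qed.

(** s - a = (1 - a sigma) / sigma, and the numerator does not vanish at r. The right side is -1 for
    r = 0 and 0 otherwise. *)
Lemma ord_at_sub r a : a * r != 1 -> ord_at sigma r (s - cst a) = - (mup r 'X)%:Z.
Proof.
move=> ar.
have A0 : 1 - a *: 'X != 0 :> {poly algC}.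
  apply/eqP => /(congr1 (fun A : {poly algC} => A.[0])).
  rewrite hornerD hornerN hornerZ hornerX hornerC horner0 mulr0 subr0.
  by move/eqP; rewrite oner_eq0.
have X0 : 'X != 0 :> {poly algC} by rewrite polyX_eq0.
rewrite (ord_atE s_tr r A0 X0).
  by rewrite mupNroot ?sub0r // /root !hornerE subr_eq0 eq_sym.
rewrite rmorphB rmorph1 -mul_polyC rmorphM /= ev_X ev_C mulrBl divff //.
by apply: contraTneq isT => s0; have := s_tr 0; rewrite s0 invr0 rmorph0 eqxx.
Qed.

Lemma ord_at_sub_root a : a != 0 -> ord_at sigma a^-1 (s - cst a) = 1.
Proof.
move=> a0; have ra0 : a^-1 != 0 by rewrite invr_eq0.
have X0 : 'X != 0 :> {poly algC} by rewrite polyX_eq0.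
have B0 : (- a)%:P * ('X - (a^-1)%:P) != 0.
  by rewrite mulf_neq0 ?polyXsubC_eq0 // polyC_eq0 oppr_eq0.
rewrite (ord_atE s_tr _ B0 X0).
  rewrite mupMr ?rootC ?oppr_eq0 // [mup _ 'X]mupNroot ?rootX // subr0.
  by have := mup_XsubCX 1 a^-1 a^-1; rewrite eqxx expr1 => ->.
have s0 : s != 0 by have := s_tr 0; rewrite rmorph0 invr_eq0.
have aK : cst a * cst a^-1 = 1 by rewrite -rmorphM mulfV // rmorph1.
rewrite rmorphM rmorphB /= ev_X !ev_C rmorphN mulrBl divff //.
by rewrite mulrBr !mulNr opprK aK addrC.
Qed.

Lemma conjugate_root g t (h : gal_of E) : h \in 'Gal(E / F)%g ->
  f = g * ('X - s%:P) -> root g t -> root g (h t).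
Proof.
move=> Gh def_f gt.
have hs : h s = s := fixed_gal sFE Gh sF.
have hf : map_poly h f = f.
  apply: (fixedPoly_gal sFE Gh); apply: polyOverSv (sub1v F) _ _.
  exact: covering_over1.
have <- : map_poly h g = g.
  apply: (mulIf (monic_neq0 (monicXsubC s))).
  rewrite -def_f -hf [in RHS]def_f rmorphM /=.
  by rewrite map_polyXsubC /= hs.
exact: rmorph_root.
Qed.

Let sigmaF : sigma \in F. Proof. by rewrite memvV. Qed.

Let evF A : ev A \in F.
Proof.
apply: rpred_horner => //; apply/polyOverP => i; rewrite coef_map.
exact: embC_mem.
Qed.

Let Qh0 : ~~ root Qh 0.
Proof.
rewrite /root horner_coef0 coef_rev_poly // subn0.
have Q0 : Q != 0 by rewrite -size_poly_eq0 size_Q.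
by rewrite -lead_coef_eq0 lead_coefE size_Q in Q0.
Qed.

Let Qh_neq0 : Qh != 0. Proof. by apply: contraNneq Qh0 => ->; rewrite root0. Qed.
Let c_neq0 : ev Qh != 0. Proof. exact: (eval_at_neq0 s_tr). Qed.

Let ord_c : ord_at sigma 0 (ev Qh) = 0.
Proof. by rewrite (ord_at_eval s_tr) // mupNroot. Qed.

Let sE t : t \in ss -> t \in E. Proof. exact: seqv_sub_adjoin. Qed.

(** The factor [ev Qh] has order 0 at sigma = 0 and makes t - a integral over Qbar[sigma]. Elements
    of the Galois group permute the roots of g, so the whole norm is integral. *)
Lemma norm_ord_ge0 g t a :
  f = g * ('X - s%:P) -> root g t -> t \in E -> t != cst a ->
  0 <= norm_ord 0 (t - cst a).
Proof.
move=> def_f gt Et ta.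
have Eta : t - cst a \in E by rewrite memvB ?embC_mem.
have ta0 : t - cst a != 0 by rewrite subr_eq0.
have cE : ev Qh \in E by exact: (subvP sFE _ (evF _)).
have -> : norm_ord 0 (t - cst a) = norm_ord 0 (ev Qh * (t - cst a)).
  by rewrite norm_ordM // [norm_ord 0 (ev Qh)]norm_ordF ?evF // ord_c mul0rn add0r.
apply: (ord_at_integral s_tr).
- by apply: normF; apply: memvM.
- by rewrite galNorm_eq0 mulf_neq0.
rewrite /galNorm; apply: big_ind => [|y z|h Gh].
- exact: integral1.
- exact: integral_mul.
rewrite rmorphM rmorphB /= (fixed_gal sFE Gh (evF _)).
rewrite (fixed_gal (sub1v _) (subsetP (galS _ (sub1v F)) _ Gh) (embC_mem _ _)).
rewrite mulrBr; apply: integral_sub.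
  apply: (integral_quotient_root size_Q size_P coprime_PQ fs def_f).
  exact: conjugate_root gt.
by rewrite -(ev_C s) -rmorphM; apply: integral_id.
Qed.

Lemma norm_ord_sub_self a : norm_ord 0 (s - cst a) = - m%:Z.
Proof.
have Fsa : s - cst a \in F by rewrite memvB ?embC_mem.
have sa0 : s - cst a != 0.
  by rewrite subr_eq0 (covering_root_transcendental coprime_PQ).
rewrite norm_ordF //.
rewrite ord_at_sub ?mulr0 1?eq_sym ?oner_neq0 //.
have := mup_XsubCX 1 (0 : algC) 0; rewrite subr0 eqxx expr1 => ->.
by rewrite mulNrn natz.
Qed.

(* These orders are >= 0, and f.[a] = - x Q(a) shows that their sum is 0. *)
Lemma norm_ord_sub_other a t : root P a -> t \in ss -> t != s ->
  norm_ord 0 (t - cst a) = 0.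
Proof.
move=> Pa t_ss ts.
have ss_rem := perm_to_rem s_ss; set rest := rem s ss in ss_rem.
have trest : t \in rest.
  by have := t_ss; rewrite (perm_mem ss_rem) in_cons (negPf ts).
pose g := cst (lead_coef P) *: \prod_(y <- rest) ('X - y%:P).
have def_f : f = g * ('X - s%:P).
  by rewrite f_ss (perm_big _ ss_rem) big_cons /= mulrC scalerAl.
have rest_ss y : y \in rest -> y \in ss by apply: mem_rem.
have lcP0 : cst (lead_coef P) != 0.
  by rewrite fmorph_eq0 lead_coef_eq0 -size_poly_eq0 size_P.
have g_root y : y \in rest -> root g y.
  by move=> yr; rewrite rootZ // root_prod_XsubC.
have ya y : y \in ss -> y != cst a.
  by move=> /f_root; apply: covering_root_transcendental.
have yaE y : y \in ss -> y - cst a \in E by move=> /sE yE; rewrite memvB ?embC_mem.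
have sum0 : \sum_(y <- rest) norm_ord 0 (y - cst a) = 0.
  have Q0 : Q.[a] != 0 by apply: coprime_PQ.
  (* f(a) = - x Q(a) is the leading coefficient of P times the product of the a - y; c collects the
     constants and signs. *)
  pose c := (-1) ^+ size ss * (- Q.[a] / lead_coef P).
  have c0 : c != 0.
    rewrite !mulf_neq0 ?signr_eq0 ?oppr_eq0 ?invr_eq0 ?lead_coef_eq0 //.
    by rewrite -size_poly_eq0 size_P.
  have prodE : \prod_(y <- ss) (y - cst a) = cst c * x.
    have PE : (map_poly cst P).[cst a] = 0 by rewrite horner_map (eqP Pa) rmorph0.
    have QE : (map_poly cst Q).[cst a] = cst Q.[a] by rewrite horner_map.
    have fa : f.[cst a] = - (x * cst Q.[a]).
      by rewrite hornerD hornerN hornerZ PE QE sub0r.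
    have /(congr1 (fun z => cst (lead_coef P)^-1 * z)) := fa.
    rewrite f_ss hornerZ mulrA -rmorphM.
    rewrite mulVf ?lead_coef_eq0 -?size_poly_eq0 ?size_P //.
    rewrite rmorph1 mul1r horner_prod => prodE; rewrite prod_subC.
    under eq_bigr do rewrite -hornerXsubC.
    rewrite prodE /c !rmorphM rmorphN rmorphXn rmorphN rmorph1 /=; ring.
  clearbody c; have ordx : ord_at sigma 0 (cst c * x) = -1.
    have XQ0 : 'X * Qh != 0 by rewrite mulf_neq0 // polyX_eq0.
    have Ph0 : ~~ root (rev_poly n.+1 P) 0.
      rewrite /root horner_coef0 coef_rev_poly // subn0.
      have := lead_coef_eq0 P; rewrite lead_coefE size_P => ->.
      by rewrite -size_poly_eq0 size_P.
    have cPh0 : ~~ root (c%:P * rev_poly n.+1 P) 0.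
      by rewrite rootM negb_or Ph0 rootC c0.
    have cP0 : c%:P * rev_poly n.+1 P != 0.
      by apply: contraNneq cPh0 => ->; rewrite root0.
    rewrite (ord_atE s_tr 0 cP0 XQ0).
      rewrite (mupNroot cPh0) mupMl // -['X]subr0.
      by have := mup_XsubCX 1 (0 : algC) 0; rewrite eqxx expr1 => ->.
    by rewrite !rmorphM /= ev_C ev_X -(covering_at size_Q size_P coprime_PQ fs); ring.
  have prod_rest : cst c * x = (s - cst a) * \prod_(y <- rest) (y - cst a).
    by rewrite -prodE (perm_big _ ss_rem) big_cons.
  have z_neq0 y : y \in ss -> y - cst a != 0 by move=> /ya; rewrite subr_eq0.
  (* c x and s - a both have a simple pole at sigma = 0, so the remaining factors have total order
     0. *)
  have := norm_ord_sub_self a; rewrite -[in RHS]natz -mulNrn -ordx.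
  have xF : cst c * x \in F by rewrite memvM ?embC_mem // rpredZ ?mem1v.
  have x0 : cst c * x != 0 by rewrite mulf_neq0 ?fmorph_eq0 // embX_eq0 polyX_eq0.
  rewrite -(norm_ordF 0 xF x0) prod_rest -(big_map (fun y => y - cst a) xpredT id).
  have restE : {subset [seq y - cst a | y <- rest] <= E}.
    by move=> _ /mapP[y /rest_ss /yaE yE ->].
  have rest0 : 0 \notin [seq y - cst a | y <- rest].
    by apply/mapP => [[y /rest_ss /z_neq0]] /[swap] <-; rewrite eqxx.
  rewrite norm_ordM ?yaE ?z_neq0 ?subfield_prod //; last first.
    by rewrite prodf_seq_neq0; apply/allP => y y_in; apply: contraNneq rest0 => <-.
  by rewrite norm_ord_prod // big_map -[LHS]addr0 => /addrI <-.
have ge0 y : y \in rest -> 0 <= norm_ord 0 (y - cst a).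
  move=> yr; apply: norm_ord_ge0 def_f (g_root y yr) _ _.
    exact/sE/rest_ss.
  exact/ya/rest_ss.
apply/eqP; move/eqP: sum0; rewrite big_seq psumr_eq0 => [|y]; last exact: ge0.
move=> /allP /(_ t trest).
by rewrite trest.
Qed.

End NormOrder.

(** * Faithfulness *)

Lemma sum_count_mem (T : eqType) (U ts : seq T) (G : T -> int) :
  uniq U -> {subset ts <= U} ->
  \sum_(t <- ts) G t = \sum_(u <- U) G u * (count_mem u ts)%:Z.
Proof.
move=> uniq_U; elim: ts => [|t ts IHts] sub.
  by rewrite big_nil big1 // => u _; rewrite mulr0.
rewrite big_cons IHts => [|u u_ts]; last by rewrite sub // inE u_ts orbT.
under [RHS]eq_bigr do rewrite /= PoszD mulrDr.
rewrite big_split /=; congr (_ + _).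
rewrite (bigD1_seq t) ?sub ?mem_head //= eqxx mulr1.
by rewrite big1 ?addr0 // => u /negPf ut; rewrite eq_sym ut mulr0.
Qed.

Section Contradiction.

Variables (L : splittingFieldType Qbarx) (P Q : {poly algC}) (n : nat).
Hypothesis size_Q : size Q = n.+1.
Hypothesis size_P : size P = n.+2.
Hypothesis coprime_PQ : forall c, root P c -> ~~ root Q c.

Local Notation cst := (embC L).
Local Notation f := (map_poly cst P - embX L 'X *: map_poly cst Q).

Variable ss : seq L.
Hypothesis f_ss : f = cst (lead_coef P) *: \prod_(t <- ss) ('X - t%:P).
Local Notation E := <<1 & ss>>%AS.

Variable p : nat.
Hypothesis p_prime : prime p.
Hypothesis p_big : (n.+1 ^ size ss < p)%N.

(** The exponents c_i are the multiplicities in [ts]. Both a and b are zeros of P, which makes t - a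
    and t - b have order 0 above s = oo for every root t != s. *)
Lemma norm_contradiction a b s1 ts z :
  root P a -> root P b -> a != 0 -> a != b ->
  s1 \in ss -> {subset ts <= ss} -> z \in E ->
  s1 - cst b = z ^+ p * \prod_(t <- ts) (t - cst a) -> False.
Proof.
move=> Pa Pb a0 ab s1_ss ts_ss Ez e.
have f_root t : t \in ss -> root f t.
  move=> t_ss; rewrite f_ss rootZ ?root_prod_XsubC //.
  by rewrite fmorph_eq0 lead_coef_eq0 -size_poly_eq0 size_P.
have sub_neq0 t c : t \in ss -> t - cst c != 0.
  by move=> /f_root ft; rewrite subr_eq0; apply: covering_root_transcendental ft.
have subE t c : t \in ss -> t - cst c \in E.
  by move=> t_ss; rewrite memvB ?embC_mem // seqv_sub_adjoin.
have z0 : z != 0.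
  have := sub_neq0 s1 b s1_ss; rewrite e; apply: contraNneq => ->.
  by rewrite expr0n gtn_eqF ?prime_gt0 // mul0r.
pose M s := #|'Gal(E / <<1; s>>%AS)%g|.
have M_dvd s k : s \in ss -> (p %| (M s)%:Z * k)%Z -> (p %| k)%Z.
  move=> s_ss; have /andP[M0 Mle] := card_gal_place size_Q size_P f_ss s_ss.
  rewrite Gauss_dvdzr // coprimezE /= prime_coprime //.
  apply: contraTN (leq_ltn_trans Mle p_big) => /dvdn_leq -/(_ M0).
  by rewrite -leqNgt.
have norm_e s r : s \in ss -> norm_ord ss s r (s1 - cst b) =
    norm_ord ss s r z * p%:Z + \sum_(t <- ts) norm_ord ss s r (t - cst a).
  move=> s_ss; rewrite e -(big_map (fun t => t - cst a) xpredT id).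
  have tsE : {subset [seq t - cst a | t <- ts] <= E}.
    by move=> _ /mapP[t /ts_ss /subE tE ->].
  have ts0 : 0 \notin [seq t - cst a | t <- ts].
    by apply/mapP => [[t /ts_ss /sub_neq0 t0]] /esym/eqP; apply/negP.
  have nM := norm_ordM size_Q size_P coprime_PQ f_ss s_ss.
  rewrite nM ?subfield_prod ?expf_neq0 ?rpredX //; last first.
    by rewrite prodf_seq_neq0; apply/allP => y y_in; apply: contraNneq ts0 => <-.
  rewrite (norm_ordX size_Q size_P coprime_PQ f_ss s_ss) //.
  rewrite (norm_ord_prod size_Q size_P coprime_PQ f_ss s_ss) // big_map.
  by rewrite -mulr_natr natz.
have norm0 s t c : root P c -> s \in ss -> t \in ss ->
    norm_ord ss s 0 (t - cst c) = - ((M s)%:Z * (t == s)%:Z).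
  move=> Pc s_ss t_ss; case: eqVneq => [-> | t_s].
    by rewrite mulr1 (norm_ord_sub_self size_Q size_P coprime_PQ f_ss s_ss).
  by rewrite mulr0 oppr0 (norm_ord_sub_other size_Q size_P coprime_PQ f_ss s_ss).
(* Orders above s = oo: only the factors with t = s contribute, each with - M s, and M s is
   invertible modulo p. *)
have count_mod s : s \in ss -> (p %| (count_mem s ts)%:Z - (s1 == s)%:Z)%Z.
  move=> s_ss; apply: (M_dvd s) => //.
  have := norm_e s 0 s_ss; rewrite norm0 // big_seq.
  rewrite (eq_bigr (fun t => - ((M s)%:Z * (t == s)%:Z))); last first.
    by move=> t /ts_ss t_ss; rewrite norm0.
  rewrite -big_seq sumrN -mulr_sumr => e_s.
  have -> : (count_mem s ts)%:Z = \sum_(t <- ts) (t == s)%:Z.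
    elim: (ts) => [|t us IH]; first by rewrite big_nil.
    by rewrite big_cons -IH /= PoszD.
  apply/dvdzP; exists (norm_ord ss s 0 z).
  rewrite mulrBr -[RHS](addrK (- ((M s)%:Z * \sum_(t <- ts) (t == s)%:Z))).
  rewrite -e_s.
  by rewrite opprK addrC.
(* The point s_1 = a in the coordinate sigma = 1/s_1. *)
pose r := a^-1.
have r0 : r != 0 by rewrite invr_eq0.
have ord_F := norm_ordF size_Q size_P coprime_PQ f_ss s1_ss r.
have s1F c : s1 - cst c \in <<1; s1>>%AS by rewrite memvB ?embC_mem // memv_adjoin.
have X0 : ~~ root 'X r by rewrite rootX.
have ar : a * r = 1 by rewrite divff.
have br : b * r != 1.
  by apply: contraNneq ab => br; rewrite -[b](divfK a0) br mul1r.
have ord_b : norm_ord ss s1 r (s1 - cst b) = 0.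
  rewrite ord_F ?s1F ?sub_neq0 // (ord_at_sub size_P coprime_PQ f_ss) //.
  by rewrite (mupNroot X0) mul0rn.
have ord_a : norm_ord ss s1 r (s1 - cst a) = M s1.
  rewrite ord_F ?s1F ?sub_neq0 // (ord_at_sub_root size_P coprime_PQ f_ss) //.
  by rewrite natz.
have uniq_U := undup_uniq ss.
have ts_U : {subset ts <= undup ss} by move=> t /ts_ss; rewrite mem_undup.
have := norm_e s1 r s1_ss; rewrite ord_b (sum_count_mem _ uniq_U ts_U) => sum0.
have /dvdzP[k sum_k] : (p %| \sum_(u <- undup ss) norm_ord ss s1 r (u - cst a) *
    ((count_mem u ts)%:Z - (s1 == u)%:Z))%Z.
  rewrite big_seq; apply: (big_ind (fun y => (p %| y)%Z)) => [|y y'|u].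
  - exact: dvdz0.
  - exact: rpredD.
  by rewrite mem_undup => /count_mod /dvdz_mull; apply.
(* Above s_1 = a the left side s_1 - b has order 0, while modulo p the right side has the order M s1
   of s_1 - a. The factor 1 fits [M_dvd]. *)
have : (p %| (M s1)%:Z * 1)%Z.
  apply/dvdzP; exists (- norm_ord ss s1 r z - k); rewrite mulrBl -sum_k.
  under eq_bigr do rewrite mulrBr.
  rewrite sumrB.
  have -> : \sum_(u <- undup ss) norm_ord ss s1 r (u - cst a) * (s1 == u)%:Z = M s1.
    rewrite (bigD1_seq s1) ?mem_undup //= eqxx mulr1 ord_a.
    rewrite big1 ?addr0 // => u /negPf us.
    by rewrite eq_sym us mulr0.
  have /eqP := esym sum0; rewrite mulNr addr_eq0 => /eqP ->.
  by rewrite opprK mulr1 subKr.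
move/(M_dvd _ _ s1_ss); rewrite dvdzE dvdn1 /= => /eqP p1.
by move: p_prime; rewrite p1.
Qed.

End Contradiction.

(** * Construction of a dessin moved by lambda *)

Definition covering_poly (P Q : {poly algC}) : {poly Qbarx} :=
  map_poly ratC P - ratX *: map_poly ratC Q.

HB.instance Definition _ := GRing.RMorphism.copy ratC
  (@FracField.tofrac {poly algC} \o polyC).

Lemma map_covering_poly (L : fieldExtType Qbarx) P Q :
  map_poly (in_alg L) (covering_poly P Q)
  = map_poly (embC L) P - embX L 'X *: map_poly (embC L) Q.
Proof.
rewrite rmorphB /= map_polyZ -!map_poly_comp.
by congr (_ - _ *: _); apply: eq_map_poly.
Qed.

Lemma splits_scaled_prod (F : fieldType) (q : {poly F}) (zs : seq F) :
  q %| \prod_(z <- zs) ('X - z%:P) ->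
  exists2 ss, {subset ss <= zs} & q = lead_coef q *: \prod_(s <- ss) ('X - s%:P).
Proof.
case/dvdp_prod_XsubC => m q_eqp.
exists (mask m zs); first by move=> s; apply: mem_mask.
by have := eqpfP q_eqp; rewrite (monicP (monic_prod_XsubC _ _ _)) divr1.
Qed.

Lemma field_is_dessin (L : fieldExtType Qbarx) :
  (forall al, al != 0 -> al != 1 -> unramified_at L al) -> is_dessin L.
Proof.
move=> unrL; exists 1%N, (fun=> L), (fun=> (idfun : {lrmorphism L -> L})).
split=> [e|_] //.
exists (e ord0); split=> [i|l]; first by rewrite [i]ord1.
exact.
Qed.

(** By the chain rule a new multiple root could only come from the critical point 0 of u. There u =
    a and P(a) - al Q(a) = - al Q(a) is nonzero. *)
Lemma simple_roots_radical (P Q : {poly algC}) (a al : algC) (p : nat) :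
  (0 < p)%N -> al != 0 -> root P a -> ~~ root Q a ->
  (forall s, root (P - al *: Q) s -> ~~ root (P - al *: Q)^`() s) ->
  let u := 'X^p + a%:P in
  forall s, root (P \Po u - al *: (Q \Po u)) s ->
    ~~ root (P \Po u - al *: (Q \Po u))^`() s.
Proof.
move=> p0 al0 Pa Qa simple u s.
rewrite -comp_polyZ -comp_polyB deriv_comp /root hornerM !horner_comp => us.
rewrite mulf_neq0 ?simple // /u derivD derivXn derivC addr0 hornerMn hornerXn.
rewrite mulrn_eq0 negb_or -lt0n p0 expf_neq0 //.
apply: contraTneq us => ->; rewrite !hornerE expr0n gtn_eqF // add0r.
by rewrite (eqP Pa) sub0r oppr_eq0 mulf_neq0.
Qed.

Lemma size_comp_radical (A : {poly algC}) (a : algC) (p : nat) : (0 < p)%N ->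
  A != 0 -> size (A \Po ('X^p + a%:P)) = ((size A).-1 * p).+1.
Proof.
move=> p0 A0; set u := 'X^p + a%:P.
have size_u : size u = p.+1 by rewrite size_XnaddC.
rewrite -[LHS]prednK ?size_comp_poly ?size_u //.
by rewrite size_poly_gt0 comp_poly_eq0 ?size_u.
Qed.

Lemma dvdp_root_exists (F : fieldType) (q : {poly F}) (zs : seq F) :
  q %| \prod_(z <- zs) ('X - z%:P) -> (1 < size q)%N -> exists z, root q z.
Proof.
case/splits_scaled_prod => [[|s ss] _ def_q].
  by rewrite def_q big_nil alg_polyC size_polyC; case: (_ != 0).
move=> q_gt1; exists s; rewrite def_q rootZ ?lead_coef_eq0 -?size_poly_gt0 1?ltnW //.
by rewrite root_prod_XsubC mem_head.
Qed.

(** Seen on the underlying ring L, a morphism from the conjugate is a ring endomorphism that acts on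
    constants by lambda and fixes x. *)
Lemma gal_conj_iso_semilinear (lambda : absGal) (L : fieldExtType Qbarx)
    (phi : {lrmorphism gal_conj lambda L -> L}) :
  exists2 phi' : {rmorphism L -> L},
    forall c, phi' (embC L c) = embC L (lambda c) & phi' (embX L 'X) = embX L 'X.
Proof.
pose phi' : {rmorphism L -> L} := (phi : {rmorphism gal_conj lambda L -> L}).
have phiE (k : Qbarx) : phi' k%:A = (gal_rat lambda k)%:A.
  have e : (k%:A : L) = gal_rat lambda k *: (1 : gal_conj lambda L).
    exact: (gal_conjP lambda L).1.
  have phi1 : phi (1 : gal_conj lambda L) = 1 := rmorph1 _.
  exact: etrans (congr1 phi e) (etrans (linearZ _ _) (congr1 _ phi1)).
exists phi' => [c|]; rewrite [LHS]phiE; congr _%:A.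
  exact: gal_ratC.
exact: gal_ratX.
Qed.

Lemma map_poly_aut_ratr (lambda : absGal) (P : {poly rat}) :
  map_poly lambda (pC P) = pC P.
Proof.
by rewrite -map_poly_comp; apply: eq_map_poly => r /=; rewrite fmorph_rat.
Qed.

Lemma moved_dessin (lambda : absGal) (a0 : algC) : lambda a0 != a0 ->
  exists2 D : dessin, regular D & ~ dessin_iso (gal_dessin lambda D) D.
Proof.
move=> moved.
have [c [P0 [Q0 [ac size_PQ coprime0 Pa simple]]]] := belyi_fraction a0.
set P := pC P0 in coprime0 Pa simple; set Q := pC Q0 in coprime0 simple.
set a := (a0 - ratr c)^-1 in Pa; pose b := lambda a.
have a_neq0 : a != 0 by rewrite invr_eq0 subr_eq0.
have Pb : root P b by rewrite -[P](map_poly_aut_ratr lambda P0) fmorph_root.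
have ab : a != b.
  apply: contraNneq moved => /(congr1 GRing.inv).
  by rewrite /b fmorphV !invrK rmorphB fmorph_rat => /addIr <-.
have coprime_PQ s : root P s -> ~~ root Q s by apply: coprime0.
have size_PQ' : size P = (size Q).+1 by rewrite !size_map_poly.
have [n size_Q] : exists n, size Q = n.+1.
  exists (size Q).-1; rewrite prednK // lt0n; apply: contraTneq Pa => Q0'.
  have /eqP/size_poly1P[k k0 ->] : size P = 1%N by rewrite size_PQ' Q0'.
  by rewrite rootC.
have size_P : size P = n.+2 by rewrite size_PQ' size_Q.
have P_neq0 : P != 0 by rewrite -size_poly_eq0 size_P.
have Q_neq0 : Q != 0 by rewrite -size_poly_eq0 size_Q.
(* n + 1 is the degree d of the covering, and also the number of elements of [ss]. *)
have [p p_big p_prime] := prime_above (n.+1 ^ n.+1).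
have p_gt0 := prime_gt0 p_prime.
pose u := 'X^p + a%:P; pose Pa' := P \Po u; pose Qa := Q \Po u.
have size_Pa : size Pa' = (n.+1 * p).+1 by rewrite size_comp_radical ?size_P.
have size_Qa : (size Qa < size Pa')%N.
  by rewrite size_Pa size_comp_radical // size_Q /= ltnS ltn_pmul2r.
have size_cov (R : fieldExtType Qbarx) (A B : {poly algC}) :
    (size B < size A)%N ->
    size (map_poly (embC R) A - embX R 'X *: map_poly (embC R) B) = size A.
  move=> lt_BA; rewrite size_polyDl ?size_map_poly // size_polyN.
  by rewrite (leq_ltn_trans (size_scale_leq _ _)) // size_map_poly.
have cov_neq0 (A B : {poly algC}) : (size B < size A)%N -> covering_poly A B != 0.
  move=> lt_BA; rewrite -(map_poly_eq0 (in_alg Qbarx^o)) map_covering_poly.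
  by rewrite -size_poly_gt0 size_cov // (leq_ltn_trans _ lt_BA).
have lt_QP : (size Q < size P)%N by rewrite size_PQ'.
(* The roots of the second factor are the p-th roots of the s_i - a. *)
have [L [zs split_zs gen_zs]] := splitting_field_exists
  (mulf_neq0 (cov_neq0 _ _ lt_QP) (cov_neq0 _ _ size_Qa)).
pose f := map_poly (embC L) P - embX L 'X *: map_poly (embC L) Q.
pose h := map_poly (embC L) Pa' - embX L 'X *: map_poly (embC L) Qa.
have {}split_zs : f * h %= \prod_(z <- zs) ('X - z%:P).
  by rewrite /f /h -!map_covering_poly -rmorphM.
have f_zs : f %| \prod_(z <- zs) ('X - z%:P).
  by rewrite -(eqp_dvdr _ split_zs) dvdp_mulr.
have h_zs : h %| \prod_(z <- zs) ('X - z%:P).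
  by rewrite -(eqp_dvdr _ split_zs) dvdp_mull.
have zs_root z : z \in zs -> root f z || root h z.
  by rewrite -rootM -root_prod_XsubC (eqp_root split_zs).
have root_cov A B z :
    root (map_poly (embC L) A - embX L 'X *: map_poly (embC L) B) z ->
    (map_poly (embC L) A).[z] = embX L 'X * (map_poly (embC L) B).[z].
  by rewrite /root hornerD hornerN hornerZ subr_eq0 => /eqP.
have unrL al : al != 0 -> al != 1 -> unramified_at L al.
  move=> al0 al1; apply: (unramified_adjoin gen_zs) => z /zs_root.
  case/orP => /root_cov z_root; [exists P, Q | exists Pa', Qa]; split=> //.
    by move=> s; apply: simple.
  by apply: simple_roots_radical => // [|s]; [apply: coprime_PQ | apply: simple].
have galL : galois 1 {:L}.
  apply: (splitting_galois (f := f * h)); last by exists zs.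
  by apply: rpredM; apply: covering_over1.
exists (Dessin (field_is_dessin unrL)).
  split; [exact: (@fieldP L) | exact: galois_aut_order].
case=> phi _; have [phi' phiC phiX] := gal_conj_iso_semilinear phi.
(* The coefficients of P and Q are rational and x is fixed, so phi' preserves the roots of f. *)
have phi_root s : root f s -> root f (phi' s).
  move=> fs; have phi_poly (A : {poly rat}) :
      phi' (map_poly (embC L) (pC A)).[s] = (map_poly (embC L) (pC A)).[phi' s].
    rewrite -horner_map -[in RHS](map_poly_aut_ratr lambda A); congr _.[_].
    by rewrite -!map_poly_comp; apply: eq_map_poly => r; apply: phiC.
  have := congr1 phi' (root_cov _ _ _ fs).
  rewrite rmorphM /= phiX !phi_poly => e.
  by rewrite /root hornerD hornerN hornerZ e subrr.
have h_root y : root h y -> root f (y ^+ p + embC L a).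
  rewrite /root !hornerD !hornerN !hornerZ /Pa' /Qa !map_comp_poly !horner_comp.
  by rewrite rmorphD /= map_polyXn map_polyC hornerD hornerXn hornerC.
have [ss ss_zs def_f] := splits_scaled_prod f_zs.
rewrite (covering_lead_coef L size_Q size_P) in def_f.
have lcP0 : embC L (lead_coef P) != 0 by rewrite fmorph_eq0 lead_coef_eq0.
have size_ss : size ss = n.+1.
  have := congr1 (fun A : {poly L} => size A) def_f.
  by rewrite size_cov // size_scale // size_prod_XsubC size_P => [[]].
have mem_ss s : (s \in ss) = root f s.
  by rewrite def_f rootZ // root_prod_XsubC.
have [y hy] : exists y, root h y.
  apply: (dvdp_root_exists h_zs); rewrite size_cov // size_Pa ltnS muln_gt0.
  by rewrite p_gt0.
pose E := <<1 & ss>>%AS.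
have ssE s : s \in ss -> s \in E by apply: seqv_sub_adjoin.
(* Both kinds of generators have their p-th power in E, so Kummer theory applies to all of [zs] at
   once. *)
have zsE z : z \in zs -> z ^+ p \in E.
  case/zs_root/orP => [fz | /h_root]; first by rewrite rpredX // ssE // mem_ss.
  by rewrite -mem_ss => /ssE ?; rewrite -[z ^+ p](addrK (embC L a)) rpredB ?embC_mem.
(* The image under phi' of the root y^p + a of f; thus s1 - b is a p-th power in L. *)
pose s1 := phi' y ^+ p + embC L b.
have s1_ss : s1 \in ss.
  rewrite mem_ss /s1 /b -phiC -rmorphXn -rmorphD; apply: phi_root; exact: h_root.
have zn : phi' y ^+ p \in E.
  by rewrite -[phi' y ^+ p](addrK (embC L b)) rpredB ?embC_mem ?ssE.
have galE : galois E {:L} by apply: galoisS galL; rewrite sub1v subvf.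
have z_in : phi' y \in <<E & zs>>%VS.
  have : phi' y \in <<1 & zs>>%VS by rewrite gen_zs memvf.
  by apply: (subvP (adjoin_seqSl _ (sub1v E))).
have [ts [ts_zs [m Em def_z]]] := kummer_radicals galE p_gt0 zsE zn z_in.
pose ts_h := [seq t ^+ p + embC L a | t <- ts & root h t].
(* Generators that are not roots of h are roots of f, hence lie in E; they join m in the p-th
   power. *)
have def_s1 : s1 - embC L b =
    (m * \prod_(t <- ts | ~~ root h t) t) ^+ p * \prod_(t <- ts_h) (t - embC L a).
  rewrite /s1 addrK def_z (bigID (root h)) /= [X in m * X]mulrC mulrA exprMn.
  congr (_ * _); rewrite -prodrXl big_map big_filter; apply: eq_bigr => t _.
  by rewrite addrK.
apply: (norm_contradiction size_Q size_P coprime_PQ def_f p_prime _ Pa Pb a_neq0 ab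
  s1_ss _ _ def_s1).
- by rewrite size_ss.
- move=> _ /mapP[t + ->]; rewrite mem_filter => /andP[ht _].
  by rewrite mem_ss h_root.
apply: memvM => //; rewrite -big_filter; apply: subfield_prod => t.
rewrite mem_filter => /andP[Nht /ts_zs /zs_root]; rewrite (negPf Nht) orbF -mem_ss.
exact: ssE.
Qed.

Theorem corollary5p8 :
  [/\ (forall (lambda : absGal) (D : dessin),
         regular D -> regular (gal_dessin lambda D)),
      (forall (lambda : absGal) (D D' : dessin),
         regular D -> regular D' -> dessin_iso D D' ->
         dessin_iso (gal_dessin lambda D) (gal_dessin lambda D')),
      (forall D : dessin, regular D -> dessin_iso (gal_dessin idfun D) D)
    & (forall (lambda mu : absGal) (D : dessin), regular D ->
         dessin_iso (gal_dessin (lambda \o mu) D)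
                    (gal_dessin lambda (gal_dessin mu D)))]
  /\ (forall lambda : absGal,
        (forall D : dessin, regular D -> dessin_iso (gal_dessin lambda D) D) ->
        lambda =1 id).
Proof.
split; first split.
- exact: gal_dessin_regular.
- by move=> lambda D D' _ _; apply: gal_dessin_iso.
- by move=> D _; apply: gal_dessin_idfun.
- by move=> lambda mu D _; apply: gal_dessin_comp.
move=> lambda fixes a; apply/eqP/negPn/negP => /moved_dessin[D regD].
by apply; apply: fixes.
Qed.
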